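(* Let $k\ge 2$, let $F=F(A)$ be a free group of rank $k$ with free basis $A=\{a_1,\dots,a_k\}$, and let $t\ge 1$ be an integer. Let $V_t\subseteq F$ be the set of all $t$-visible elements of $F$. Then the strict annular density $\sigma_A(V_t)$ exists and $$\sigma_A(V_t)=\frac{1}{t^k\zeta(k)}.$$ Moreover, $$0<\frac{4k-4}{(2k-1)^2t^k\zeta(k)}\le\liminf_{n\to\infty}\frac{\rho_A(n,V_t)}{\rho_A(n,F)}\le\limsup_{n\to\infty}\frac{\rho_A(n,V_t)}{\rho_A(n,F)}\le 1-\frac{4k-4}{(2k-1)^2}\left(1-\frac{1}{t^k\zeta(k)}\right)<1.$$
   Context: Let $\alpha:F\to\mathbb{Z}^k$ be the abelianization homomorphism, $\alpha(a_i)=e_i$. A nonzero point $z\in\mathbb{Z}^k$ is $t$-visible if the greatest common divisor of its coordinates equals $t$. An element $w\in F$ is $t$-visible if $\alpha(w)$ is $t$-visible in $\mathbb{Z}^k$. For $w\in F$, $|w|_A$ is the freely reduced length of $w$ with respect to $A$. For $X\subseteq F$ and $n\ge 0$, $\gamma_A(n,X)=\#\{w\in X:|w|_A=n\}$ and $\rho_A(n,X)=\#\{w\in X:|w|_A\le n\}$. The strict annular density of $X\subseteq F$ is $$\sigma_A(X)=\lim_{n\to\infty}\frac12\left(\frac{\gamma_A(n-1,X)}{\gamma_A(n-1,F)}+\frac{\gamma_A(n,X)}{\gamma_A(n,F)}\right),$$ provided this limit exists. $\zeta$ is the Riemann zeta-function. *)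

(* Defs.v *)
From HB Require Import structures.
From mathcomp Require Import all_boot all_order all_algebra.
From mathcomp Require Import finmap.
From mathcomp Require Import all_classical all_reals all_analysis.

Set Implicit Arguments.
Unset Strict Implicit.
Unset Printing Implicit Defensive.

Import Order.TTheory GRing.Theory Num.Theory.
Import numFieldNormedType.Exports.

Local Open Scope classical_set_scope.
Local Open Scope ring_scope.

(* The free group on a_0, ..., a_{k-1}, realised as the group of freely       *)
(* reduced words in the letters a_i = (i, false) and a_i^-1 = (i, true).      *)

Notation letter k := ('I_k * bool)%type.

Definition linv k (l : letter k) : letter k := (l.1, ~~ l.2).

Definition reduced k (s : seq (letter k)) : bool :=
  sorted (fun l l' => l' != linv l) s.

Record freegroup (k : nat) := FreeGroup {
  word :> seq (letter k);
  word_reduced : reduced word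
}.

HB.instance Definition _ k := [isSub for @word k].
HB.instance Definition _ k := [Countable of freegroup k by <:].

Section FreeGroupLaws.
Variable k : nat.
Implicit Types (l : letter k) (s t : seq (letter k)) (u v w : freegroup k).

Definition lcons l s : seq (letter k) :=
  if s is l' :: s' then if l' == linv l then s' else l :: s else [:: l].

Definition reduce s : seq (letter k) := foldr lcons [::] s.

Definition invw s : seq (letter k) := rev (map (@linv k) s).

Lemma linvK : involutive (@linv k).
Proof. by case=> i b; rewrite /linv /= negbK. Qed.

Lemma lcons_reduced l s : reduced s -> reduced (lcons l s).
Proof.
case: s => //= l' s; case: ifPn => [_ /path_sorted //|nl ps].
by rewrite /reduced /= nl.
Qed.

Lemma lconsK l s : reduced s -> lcons (linv l) (lcons l s) = s.
Proof.
case: s => [|l' s] /=; first by rewrite linvK eqxx.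
case: (eqVneq l' (linv l)) => [-> | _]; last by rewrite /= linvK eqxx.
by case: s => //= l'' s /andP[/negPf -> _].
Qed.

Lemma foldr_lcons_reduced s t : reduced t -> reduced (foldr lcons t s).
Proof. by move=> rt; elim: s => //= l s; apply: lcons_reduced. Qed.

Lemma reduce_reduced s : reduced (reduce s).
Proof. exact: foldr_lcons_reduced. Qed.

Lemma reduce_id s : reduced s -> reduce s = s.
Proof.
elim: s => //= l s IHs rs; rewrite IHs; last exact: path_sorted rs.
by case: s rs {IHs} => //= l' s /andP[/negPf -> _].
Qed.

Lemma foldr_reduce s t : reduced t -> foldr lcons t (reduce s) = foldr lcons t s.
Proof.
move=> rt; elim: s => //= l s IHs; rewrite -{}IHs.
case E: (reduce s) => [|l' r] //=; case: eqP => //= ->.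
by rewrite -{1}(linvK l) lconsK // foldr_lcons_reduced.
Qed.

Definition fg_one : freegroup k := @FreeGroup k [::] isT.
Definition fg_mul u v : freegroup k := FreeGroup (reduce_reduced (u ++ v)).
Definition fg_inv u : freegroup k := FreeGroup (reduce_reduced (invw u)).

Lemma fg_mulE u v : word (fg_mul u v) = foldr lcons v u.
Proof. by rewrite /= /reduce foldr_cat -/(reduce v) reduce_id //; case: v. Qed.

Lemma fg_mulA : associative fg_mul.
Proof.
move=> u v w; apply: val_inj.
change (word (fg_mul u (fg_mul v w)) = word (fg_mul (fg_mul u v) w)).
by rewrite !fg_mulE -foldr_cat -(foldr_reduce (u ++ v) (word_reduced w)) -fg_mulE.
Qed.

Lemma fg_mul1 : left_id fg_one fg_mul.
Proof. by move=> u; apply: val_inj; rewrite /= reduce_id //; case: u. Qed.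

Lemma fg_mulr1 : right_id fg_one fg_mul.
Proof. by move=> u; apply: val_inj; rewrite /= cats0 reduce_id //; case: u. Qed.

Lemma invwK : involutive invw.
Proof. by move=> s; rewrite /invw map_rev revK mapK //; exact: linvK. Qed.

Lemma foldr_lcons_invw s t :
  reduced t -> foldr lcons (foldr lcons t s) (invw s) = t.
Proof.
move=> rt; rewrite /invw; elim: s => //= l s IHs.
by rewrite rev_cons foldr_rcons lconsK // foldr_lcons_reduced.
Qed.

Lemma fg_mulV : left_inverse fg_one fg_inv fg_mul.
Proof.
move=> u; apply: val_inj; change (word (fg_mul (fg_inv u) u) = [::]).
have ru : reduced u by case: u.
rewrite fg_mulE /= foldr_reduce // -[X in foldr _ X]reduce_id //.
exact: foldr_lcons_invw.
Qed.

Lemma fg_mulVr : right_inverse fg_one fg_inv fg_mul.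
Proof.
move=> u; rewrite -[LHS]fg_mul1 -{1}(fg_mulV (fg_inv u)) -fg_mulA.
by rewrite [X in fg_mul _ X]fg_mulA fg_mulV fg_mul1 fg_mulV.
Qed.

End FreeGroupLaws.

HB.instance Definition _ k := isGroup.Build (freegroup k)
  (@fg_mulA k) (@fg_mul1 k) (@fg_mulr1 k) (@fg_mulV k) (@fg_mulVr k).

Definition gen k (i : 'I_k) : freegroup k := @FreeGroup k [:: (i, false)] isT.

(* The length |w|_A with respect to the basis A = {gen 0, ..., gen (k-1)}.    *)
Definition wlen k (w : freegroup k) : nat := size (word w).

Lemma freegroup_ind k (P : freegroup k -> Prop) :
  P 1%g -> (forall i w, P w -> P (gen i * w)%g) ->
  (forall i w, P w -> P ((gen i)^-1 * w)%g) -> forall w, P w.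
Proof.
move=> P1 PM PV [s rs]; elim: s rs => [|[i b] s IHs] rs.
  by rewrite (_ : FreeGroup rs = 1%g) //; apply: val_inj.
have rs' : reduced s := path_sorted rs.
case: b rs => rs; have := IHs rs'; [move/(PV i) | move/(PM i)].
- rewrite (_ : (_ * _)%g = FreeGroup rs) //; apply: val_inj.
  by rewrite -[RHS](reduce_id rs).
- rewrite (_ : (_ * _)%g = FreeGroup rs) //; apply: val_inj.
  by rewrite -[RHS](reduce_id rs).
Qed.

(* Freeness: every map from the basis to a group extends to a unique          *)
(* homomorphism.                                                              *)
Lemma freegroup_universal k (G : groupType) (f : 'I_k -> G) :
  exists h : freegroup k -> G,
    [/\ {morph h : u v / (u * v)%g}, forall i, h (gen i) = f i &
        forall h' : freegroup k -> G, {morph h' : u v / (u * v)%g} ->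
          (forall i, h' (gen i) = f i) -> h' =1 h].
Proof.
pose lv (l : letter k) : G := if l.2 then (f l.1)^-1%g else f l.1.
pose ev (s : seq (letter k)) : G := foldr (fun l x => lv l * x)%g 1%g s.
have lvV l : lv (linv l) = (lv l)^-1%g by case: l => i [] //=; rewrite /lv /= invgK.
have ev_lcons l s : ev (lcons l s) = (lv l * ev s)%g.
  case: s => //= l' s; case: eqP => //= ->.
  by rewrite lvV mulgA mulgV mul1g.
have ev_foldr s t : ev (foldr (@lcons k) t s) = (ev s * ev t)%g.
  by elim: s => [|l s IHs] /=; rewrite ?mul1g // ev_lcons IHs mulgA.
have evM : {morph (fun w : freegroup k => ev w) : u v / (u * v)%g}.
  by move=> u v; rewrite [LHS](congr1 ev (fg_mulE u v)) ev_foldr.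
exists ev; split=> // [i|h' h'M h'g w].
  by rewrite /= mulg1.
have h'1 : h' 1%g = 1%g by apply: (mulgI (h' 1%g)); rewrite -h'M !mulg1.
have ev1 : ev (1%g : freegroup k) = 1%g by [].
have h'V u : h' u^-1%g = (h' u)^-1%g.
  by apply: (mulgI (h' u)); rewrite -h'M !mulgV h'1.
have evg i : ev (gen i) = f i by rewrite /= mulg1.
have evV u : ev (u^-1%g : freegroup k) = (ev u)^-1%g.
  by apply: (mulgI (ev u)); rewrite -evM !mulgV.
elim/freegroup_ind: w => // i w IHw; rewrite h'M evM IHw.
  by rewrite h'g evg.
by rewrite h'V evV h'g evg.
Qed.

(* Abelianization F -> Z^k: coordinate i is the exponent sum of a_i in w. It  *)
(* is the homomorphism with a_i |-> e_i, see abelM, abel_gen and              *)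
(* freegroup_ind.                                                             *)
Definition abel k (w : freegroup k) : 'rV[int]_k :=
  \sum_(l <- word w) (-1) ^+ l.2 *: delta_mx 0 l.1.

Lemma abelM k : {morph @abel k : u v / (u * v)%g >-> u + v}.
Proof.
move=> u v; rewrite /abel (fg_mulE u v).
elim: (word u) => [|l s IHs] /=; first by rewrite big_nil add0r.
rewrite big_cons -addrA -{}IHs.
case: (foldr _ _ _) => [|l' t] /=; first by rewrite !big_cons.
case: eqP => [->|_]; rewrite !big_cons //= addrA -scalerDl.
by case: l.2; rewrite ?addNr ?subrr scale0r add0r.
Qed.

Lemma abel_gen k (i : 'I_k) : abel (gen i) = delta_mx 0 i.
Proof. by rewrite /abel big_seq1 scale1r. Qed.

Definition gcd_coords k (z : 'rV[int]_k) : nat :=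
  \big[gcdn/0%N]_(i < k) `|z 0%R i|%N.

Definition visible_point k (t : nat) (z : 'rV[int]_k) : Prop :=
  z != 0 /\ gcd_coords z = t.

Definition visible k (t : nat) : set (freegroup k) :=
  [set w | visible_point t (abel w)].
Arguments visible k t : clear implicits.

(* #|` fset_set S| is the number of elements of S when S is finite, and 0     *)
(* otherwise; only subsets of balls occur here, see finite_ball.              *)
Definition gamma k (n : nat) (X : set (freegroup k)) : nat :=
  #|` fset_set [set w | X w /\ wlen w = n]|.

Definition rho k (n : nat) (X : set (freegroup k)) : nat :=
  #|` fset_set [set w | X w /\ (wlen w <= n)%N]|.

Lemma finite_ball k n : finite_set [set w : freegroup k | (wlen w <= n)%N].
Proof.
pose f (p : {m : 'I_n.+1 & m.-tuple (letter k)}) : freegroup k :=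
  FreeGroup (reduce_reduced (tagged p)).
apply: (@sub_finite_set _ _ (f @` setT)); last first.
  exact/finite_image/finite_finset.
move=> [s rs] /= sn; have lt_sn : (size s < n.+1)%N by [].
exists (Tagged (fun m : 'I_n.+1 => m.-tuple (letter k))
  (in_tuple s : (Ordinal lt_sn).-tuple _)) => //.
by apply: val_inj; rewrite /= reduce_id.
Qed.

Section Density.
Variables (R : realType) (k : nat).

(* At n = 0 the predecessor is truncated; this does not affect the limit.     *)
Definition annular_ratio (X : set (freegroup k)) : R^nat := fun n =>
  2%:R^-1 * ((gamma n.-1 X)%:R / (gamma n.-1 [set: freegroup k])%:R +
             (gamma n X)%:R / (gamma n [set: freegroup k])%:R).

Definition has_strict_annular_density (X : set (freegroup k)) : Prop :=
  cvgn (annular_ratio X).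

Definition strict_annular_density (X : set (freegroup k)) : R :=
  limn (annular_ratio X).

Definition ball_ratio (X : set (freegroup k)) : R^nat := fun n =>
  (rho n X)%:R / (rho n [set: freegroup k])%:R.

End Density.

(* The Riemann zeta function on the half-line s > 1, where the series         *)
(* converges.                                                                 *)
Definition zeta (R : realType) (s : R) : R :=
  limn (series (fun n => n.+1%:R `^ (- s))).

(* Main.v *)
Require Import Defs.
From mathcomp Require Import all_boot all_order all_algebra.
From mathcomp Require Import finmap.
From mathcomp Require Import all_classical all_reals all_analysis.
From mathcomp Require Import ring lra zify.

Set Implicit Arguments.
Unset Strict Implicit.
Unset Printing Implicit Defensive.

Import Order.TTheory GRing.Theory Num.Theory.
Import numFieldNormedType.Exports.

Local Open Scope classical_set_scope.
Local Open Scope ring_scope.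

(* A random reduced word of length n is a non-backtracking walk, so the joint *)
(* law of its first letter and of its image in a finite abelian group G       *)
(* evolves under an averaging operator T on functions on letters x G. The l^2 *)
(* norm of the law decreases under T by an explicit dispersion, which yields  *)
(*  - equidistribution: the dispersion tends to 0, hence the average of the   *)
(*    laws at times n and n + 1 tends to the uniform law on G; in particular  *)
(*    the annular density of { d | alpha(w) } is d^-k;                        *)
(*  - a Nash inequality along two coordinates of G = (Z/d)^k: a word of       *)
(*    length n satisfies d | alpha(w) with probability O(1/d^2 + 1/n).        *)
(* Together with the bound E |alpha(w)|^2 <= 2 n, the latter shows that       *)
(* gcd(alpha(w)) is tight, so that a sieve yields the law of the gcd. As the  *)
(* limits are proportional to t^-k and sum to 1, the constant is 1 / zeta(k). *)
(* The ball of radius n is compared to its spheres of radii n - 1 and n.      *)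

(** * The averaging operator on letters x G *)

(** The law of gcd(alpha(w)) is never computed directly: proportionality and total mass force it.
    Modulo d, a uniform reduced word is a non-backtracking walk on (Z/d)^k, and [equidistribution]
    makes d | alpha(w) hold with limiting probability d^-k, once two consecutive lengths are
    averaged. For even d the parity of the length shows in the image, which is why the density is
    annular. From these probabilities alone, [sieve_gcdn] finds that gcd(j, t m) = t has limiting
    probability t^-k times a constant free of t.

    Taking m = D! and replacing that event by j = t requires that large gcds be rare uniformly in n,
    as mass could otherwise escape to infinity. This is [gcd_tail_small]: a union bound with the
    estimate O(1/d^2 + 1/n) of [div_prob_le] handles moderate values, and the second moment of
    alpha(w) handles those above about n^(3/4). Hence the probability of t is asymptotically t^-k
    times that of 1 ([sieve_ratio]), and summing over t gives zeta(k) times the probability of 1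
    tending to 1 ([sieve_unit]).

    For balls, the two outermost spheres already carry a fixed fraction of the ball
    ([ball_word_ratio_ge]). Applied to the visible words this bounds the liminf, applied to their
    complement it bounds the limsup. *)

Section FiniteSums.
Variables (R : realFieldType) (I : finType).
Implicit Types a : I -> R.

Lemma sum_sqr_diff a :
  \sum_i \sum_j (a i - a j) ^+ 2 =
  2 * (#|I|%:R * \sum_i a i ^+ 2 - (\sum_i a i) ^+ 2).
Proof.
have -> : \sum_i \sum_j (a i - a j) ^+ 2 =
    \sum_i (#|I|%:R * a i ^+ 2 - 2 * (a i * \sum_j a j) + \sum_j a j ^+ 2).
  apply: eq_bigr => i _.
  have -> : \sum_j (a i - a j) ^+ 2 =
      \sum_j (a i ^+ 2 - 2 * (a i * a j) + a j ^+ 2).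
    by apply: eq_bigr => j _; ring.
  rewrite !big_split /= sumrN -!mulr_sumr sumr_const -[_ *+ #|_|]mulr_natl; ring.
rewrite !big_split /= sumrN -!mulr_sumr -mulr_suml sumr_const.
rewrite -[_ *+ #|_|]mulr_natl; ring.
Qed.

Lemma sqr_sum_le a : (\sum_i a i) ^+ 2 <= #|I|%:R * \sum_i a i ^+ 2.
Proof.
have : 0 <= \sum_i \sum_j (a i - a j) ^+ 2.
  by apply: sumr_ge0 => i _; apply: sumr_ge0 => j _; apply: sqr_ge0.
by rewrite sum_sqr_diff pmulr_rge0 ?subr_ge0.
Qed.

Lemma le_bigT a i : (forall j, 0 <= a j) -> a i <= \sum_j a j.
Proof.
by move=> a0; rewrite (bigD1 i) //= lerDl; apply: sumr_ge0 => j _.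
Qed.

End FiniteSums.

Lemma sum_shift (R : nmodType) (G : finZmodType) (h : G -> R) (x : G) :
  \sum_g h (g + x) = \sum_g h g.
Proof.
rewrite [RHS](reindex_inj (h := fun g => g + x)) //; exact: addIr.
Qed.

Section Transfer.
Variables (R : realFieldType) (k : nat) (G : finZmodType) (e : letter k -> G).
Hypotheses (k2 : (2 <= k)%N) (eV : forall l, e (linv l) = - e l).
Implicit Types (f : letter k -> G -> R) (g h : G) (l : letter k).

Let N : R := (2 * k)%:R.
Let q : R := (2 * k).-1%:R.

(** One step of the walk: if [f] is the joint law of first letter and image, the new letter [l] is
    prepended with probability 1/(2k-1) to each word whose first letter it does not cancel. *)
Definition transfer f l g : R :=
  (\sum_(l' | l' != linv l) f l' (g - e l)) / (2 * k).-1%:R.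

Definition marginal f g : R := \sum_l f l g.
Definition mass f : R := \sum_g marginal f g.
Definition energy f : R := \sum_g \sum_l f l g ^+ 2.
Definition dispersion f : R := \sum_g \sum_l \sum_l' (f l g - f l' g) ^+ 2.

Lemma linv_inj : injective (@linv k).
Proof. exact: can_inj (@linvK k). Qed.

Lemma card_letter : #|{: letter k}| = (2 * k)%N.
Proof. by rewrite card_prod card_ord card_bool mulnC. Qed.

Let q_ge3 : 3 <= q.
Proof. by rewrite /q ler_nat; lia. Qed.

Let q_neq0 : q != 0.
Proof. by rewrite gt_eqF // (lt_le_trans _ q_ge3). Qed.

Let q_gt0 : 0 < q.
Proof. exact: lt_le_trans q_ge3. Qed.

Let q_ge1 : 1 <= q.
Proof. by apply: le_trans q_ge3; rewrite ler1n. Qed.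

Let NE : N = q + 1.
Proof. by rewrite /N /q -[1]/(1%:R) -natrD; congr _%:R; lia. Qed.

Let card_letterR : #|{: letter k}|%:R = N.
Proof. by rewrite card_letter. Qed.

Lemma transferE f l g :
  transfer f l g = (marginal f (g - e l) - f (linv l) (g - e l)) / q.
Proof.
by rewrite /transfer /marginal [\sum_l' _ in RHS](bigD1 (linv l)) //= addrAC subrr add0r.
Qed.

Lemma transfer_ge0 f : (forall l g, 0 <= f l g) -> forall l g, 0 <= transfer f l g.
Proof.
by move=> f0 l g; rewrite /transfer divr_ge0 // sumr_ge0.
Qed.

Lemma mass_transfer f : mass (transfer f) = mass f.
Proof.
rewrite /mass /marginal exchange_big /=.
under eq_bigr => l _.
  under eq_bigr do rewrite transferE.
  rewrite (sum_shift (fun g => (marginal f g - f (linv l) g) / q) (- e l)).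
  over.
rewrite exchange_big /=; apply: eq_bigr => g _.
rewrite -mulr_suml sumrB sumr_const card_letter.
have -> : \sum_l f (linv l) g = marginal f g by rewrite [RHS](reindex_inj linv_inj).
rewrite -[_ *+ _]mulr_natl -/N NE.
rewrite -[RHS]/(marginal f g); field; exact: q_neq0.
Qed.

(** Over a fixed point of G, and up to relabelling letters and translating, the operator sends f_l
    to (M - f_l) / q, with M the sum of the f_l. It fixes constants and multiplies vectors of sum
    zero by -1/q, so only the dispersion is lost. *)
Lemma energy_transfer f :
  energy f - energy (transfer f) = (q - 1) / (2 * q ^+ 2) * dispersion f.
Proof.
have -> : energy (transfer f) =
    \sum_g \sum_l ((marginal f g - f l g) / q) ^+ 2.
  rewrite /energy exchange_big [RHS]exchange_big /=.
  rewrite [RHS](reindex_inj linv_inj) /=; apply: eq_bigr => l _.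
  under eq_bigr do rewrite transferE.
  by rewrite (sum_shift (fun g => ((marginal f g - f (linv l) g) / q) ^+ 2)).
rewrite /energy /dispersion -sumrB mulr_sumr; apply: eq_bigr => g _.
rewrite sum_sqr_diff card_letterR NE.
have -> : \sum_l ((marginal f g - f l g) / q) ^+ 2 =
  ((q - 1) * marginal f g ^+ 2 + \sum_l f l g ^+ 2) / q ^+ 2.
  under eq_bigr => l _ do rewrite expr_div_n.
  rewrite -mulr_suml; congr (_ / _).
  have -> : \sum_l (marginal f g - f l g) ^+ 2 =
    \sum_l (marginal f g ^+ 2 - 2 * marginal f g * f l g + f l g ^+ 2).
    by apply: eq_bigr => l _; ring.
  rewrite !big_split /= sumrN sumr_const.
  rewrite -[_ *+ #|_|]mulr_natl card_letterR NE.
  rewrite -mulr_sumr -/(marginal f g); ring.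
by rewrite -/(marginal f g); field; exact: q_neq0.
Qed.

Lemma dispersion_ge0 f : 0 <= dispersion f.
Proof.
by do 3!(apply: sumr_ge0 => ? _); apply: sqr_ge0.
Qed.

Lemma energy_ge0 f : 0 <= energy f.
Proof. by do 2!(apply: sumr_ge0 => ? _); apply: sqr_ge0. Qed.

Lemma energy_transfer_le f : energy (transfer f) <= energy f.
Proof.
rewrite -subr_ge0 energy_transfer mulr_ge0 ?dispersion_ge0 //.
by rewrite divr_ge0 ?mulr_ge0 ?exprn_ge0 ?subr_ge0 ?(ltW q_gt0).
Qed.

Lemma energy_le_marginal f : (forall l g, 0 <= f l g) ->
  energy f <= \sum_g marginal f g ^+ 2.
Proof.
move=> f0; apply: ler_sum => g _; rewrite expr2 mulr_suml.
apply: ler_sum => l _; rewrite expr2 ler_wpM2l //.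
exact: (le_bigT (a := f^~ g)).
Qed.

Lemma marginal_le_energy f : \sum_g marginal f g ^+ 2 <= N * energy f.
Proof.
rewrite /energy mulr_sumr; apply: ler_sum => g _.
by rewrite -card_letterR sqr_sum_le.
Qed.

(* Both (2k) * transfer f l g - marginal f (g - e l) and the deviation of      *)
(* marginal (transfer f) g from (2k) * transfer f l g are differences between  *)
(* letters, hence controlled by the dispersions.                               *)
Lemma marginal_transfer_diff f l :
  \sum_g (marginal (transfer f) g - marginal f (g - e l)) ^+ 2 <=
  2 * N * (dispersion f + dispersion (transfer f)).
Proof.
have -> : dispersion f = \sum_g \sum_m \sum_l' (f m (g - e l) - f l' (g - e l)) ^+ 2.
  by rewrite (sum_shift (fun h => \sum_m \sum_l' (f m h - f l' h) ^+ 2)).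
rewrite -big_split mulr_sumr /=; apply: ler_sum => g _; set h := g - e l.
pose a := \sum_m (transfer f m g - transfer f l g).
pose b := \sum_m (f m h - f (linv l) h).
have -> : marginal (transfer f) g - marginal f h = a + b / q.
  rewrite /a /b !sumrB !sumr_const -/(marginal f h) -/(marginal (transfer f) g).
  rewrite card_letter -(mulr_natl (transfer f l g)) -(mulr_natl (f (linv l) h)).
  by rewrite -/N NE transferE -/h; field; exact: q_neq0.
have sqD (x y : R) : (x + y) ^+ 2 <= 2 * (x ^+ 2 + y ^+ 2).
  by rewrite -subr_ge0 (_ : _ - _ = (x - y) ^+ 2) ?sqr_ge0 //; ring.
apply: le_trans (sqD _ _) _; rewrite -mulrA; apply: ler_wpM2l => //.
have rowle (u : letter k -> R) m0 :
    (\sum_m (u m - u m0)) ^+ 2 <= N * \sum_m \sum_l' (u m - u l') ^+ 2.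
  apply: le_trans (sqr_sum_le _) _; rewrite card_letterR ler_wpM2l //.
  apply: ler_sum => m _; apply: (le_bigT (a := fun l' => (u m - u l') ^+ 2)) => j.
  exact: sqr_ge0.
rewrite addrC mulrDr lerD //; first exact: (rowle ((transfer f)^~ g) l).
apply: le_trans (rowle (f^~ h) (linv l)).
rewrite expr_div_n ler_pdivrMr ?exprn_gt0 //.
by rewrite ler_peMr ?sqr_ge0 // expr_ge1 ?(ltW q_gt0).
Qed.

End Transfer.

(** * Nash inequality and decay of the energy *)

Section Nash.
Variables (R : realFieldType) (G : finZmodType).
Implicit Types (S : G -> R) (y : G).

Definition shift_energy S y : R := \sum_g (S g - S (g + y)) ^+ 2.

Lemma shift_energy_ge0 S y : 0 <= shift_energy S y.
Proof. by apply: sumr_ge0 => g _; apply: sqr_ge0. Qed.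

Lemma shift_energyD S y y' :
  shift_energy S (y + y') <= 2 * (shift_energy S y + shift_energy S y').
Proof.
have -> : shift_energy S y' = \sum_g (S (g + y) - S (g + y + y')) ^+ 2.
  by rewrite (sum_shift (fun h => (S h - S (h + y')) ^+ 2)).
rewrite /shift_energy -big_split mulr_sumr /=; apply: ler_sum => g _.
rewrite addrA -subr_ge0.
rewrite (_ : _ - _ = (S g - S (g + y) - (S (g + y) - S (g + y + y'))) ^+ 2) ?sqr_ge0 //.
ring.
Qed.

(** Induction with (x + y)^2 <= (1 + 1/n) x^2 + (1 + n) y^2, whose weights turn n^2 into exactly (n
    + 1)^2; iterating [shift_energyD] would cost a factor 2 at each step. *)
Lemma shift_energyMn S y n :
  shift_energy S (y *+ n) <= n%:R ^+ 2 * shift_energy S y.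
Proof.
elim: n => [|n IHn].
  rewrite mulr0n expr0n mul0r /shift_energy big1 // => g _.
  by rewrite addr0 subrr expr0n.
have [->|n0] := posnP n; first by rewrite mulr1n expr1n mul1r.
have n0' : 0 < n%:R :> R by rewrite ltr0n.
have -> : n.+1%:R ^+ 2 * shift_energy S y =
  (1 + n%:R^-1) * (n%:R ^+ 2 * shift_energy S y) + (1 + n%:R) * shift_energy S y.
  by rewrite -natr1; field; rewrite gt_eqF.
apply: (@le_trans _ _ ((1 + n%:R^-1) * shift_energy S (y *+ n) +
    (1 + n%:R) * shift_energy S y)); last first.
  by rewrite lerD2r ler_wpM2l // addr_ge0 // invr_ge0 ltW.
rewrite mulrSr.
have -> : shift_energy S y = \sum_g (S (g + y *+ n) - S (g + y *+ n + y)) ^+ 2.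
  by rewrite (sum_shift (fun h => (S h - S (h + y)) ^+ 2)).
rewrite /shift_energy !mulr_sumr -big_split; apply: ler_sum => g _ /=.
rewrite addrA; set a := S g; set b := S _; set c := S _; rewrite -subr_ge0.
rewrite (_ : _ - _ = n%:R^-1 * ((a - c) - n%:R * (c - b)) ^+ 2).
  by rewrite mulr_ge0 ?sqr_ge0 // invr_ge0 ltW.
by field; rewrite gt_eqF.
Qed.

Lemma sum_mul_diff S y :
  \sum_g S g * (S g - S (g + y)) = shift_energy S y / 2.
Proof.
have -> : shift_energy S y =
    \sum_g (2 * (S g * (S g - S (g + y))) + S (g + y) ^+ 2 - S g ^+ 2).
  by apply: eq_bigr => g _; ring.
rewrite !big_split /= sumrN (sum_shift (fun h => S h ^+ 2)) addrK -mulr_sumr.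
by field.
Qed.

(* Compare S with its average over the box { i y1 + j y2 : i, j < r }, which  *)
(* injectivity bounds by 1 / r^2.                                             *)
Lemma nash S (y1 y2 : G) (r : nat) : (0 < r)%N ->
  (forall g, 0 <= S g) -> \sum_g S g = 1 ->
  injective (fun p : 'I_r * 'I_r => y1 *+ p.1 + y2 *+ p.2) ->
  \sum_g S g ^+ 2 <= r%:R ^- 2 +
    r%:R ^+ 2 * (shift_energy S y1 + shift_energy S y2).
Proof.
move=> r0 S0 S1 inj; set y := (fun p => _) in inj.
have r0' : 0 < r%:R :> R by rewrite ltr0n.
have -> : \sum_g S g ^+ 2 = r%:R ^- 2 *
   (\sum_g S g * (\sum_p S (g + y p)) + \sum_p \sum_g S g * (S g - S (g + y p))).
  have -> : \sum_g S g * (\sum_p S (g + y p)) = \sum_p \sum_g S g * S (g + y p).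
    by rewrite exchange_big; apply: eq_bigr => g _; rewrite mulr_sumr.
  rewrite -big_split /=.
  rewrite [X in _ * X](eq_bigr (fun=> \sum_g S g ^+ 2)).
    rewrite sumr_const card_prod card_ord -[_ *+ (r * r)]mulr_natl natrM.
    by field; rewrite gt_eqF.
  by move=> p _; rewrite -big_split; apply: eq_bigr => g _ /=; ring.
rewrite mulrDr; apply: lerD.
  rewrite ler_piMr ?invr_ge0 ?sqr_ge0 // -[leRHS]S1; apply: ler_sum => g _.
  (* The translates g + y p are distinct, so their masses sum to at most 1. *)
  rewrite ler_piMr // -S1 -(sum_shift S g).
  under [leRHS]eq_bigr do rewrite addrC.
  rewrite [leRHS](bigID (mem (y @: predT))) /= big_imset; last exact: in2W.
  by under [X in _ <= X + _]eq_bigl do rewrite inE; rewrite lerDl sumr_ge0.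
rewrite ler_pdivrMl ?exprn_gt0 //.
apply: (@le_trans _ _ (\sum_(p : 'I_r * 'I_r)
    (r%:R ^+ 2 * (shift_energy S y1 + shift_energy S y2)))).
  apply: ler_sum => -[i j] _; rewrite sum_mul_diff ler_pdivrMr // mulrC.
  apply: le_trans (shift_energyD _ _ _) _; rewrite ler_pM2l // mulrDr /=.
  have sq_le (m : 'I_r) : m%:R ^+ 2 <= r%:R ^+ 2 :> R.
    by rewrite lerXn2r ?nnegrE // ler_nat ltnW.
  by apply: lerD; apply: le_trans (shift_energyMn _ _ _) _;
    rewrite ler_wpM2r ?shift_energy_ge0.
by rewrite sumr_const card_prod card_ord -[_ *+ (r * r)]mulr_natl natrM expr2.
Qed.

End Nash.

Section Decay.
Variables (R : realFieldType) (k : nat) (G : finZmodType) (e : letter k -> G).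
Hypotheses (k2 : (2 <= k)%N) (eV : forall l, e (linv l) = - e l).
Implicit Types (f : letter k -> G -> R) (g h : G) (l : letter k).

(** The values of [marginal f] at g - e l and g + e l are both close to [marginal (transfer e f) g].
    Only the doubled shift is controlled, since at a single time the marginal may live on one parity
    class. *)
Lemma shift_energy_marginal f l :
  shift_energy (marginal f) (e l *+ 2) <=
  8 * (2 * k)%:R * (dispersion f + dispersion (transfer e f)).
Proof.
set D := _ + _.
have step l' : \sum_g (marginal (transfer e f) g - marginal f (g - e l')) ^+ 2 <=
    2 * (2 * k)%:R * D by exact: marginal_transfer_diff.
rewrite /shift_energy -(sum_shift _ (- e l)).
apply: (@le_trans _ _ (2 * (\sum_g (marginal (transfer e f) g - marginal f (g - e l)) ^+ 2 +
  \sum_g (marginal (transfer e f) g - marginal f (g - e (linv l))) ^+ 2))).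
  rewrite -big_split mulr_sumr /=; apply: ler_sum => g _.
  rewrite mulr2n addrA subrK eV opprK.
  set a := marginal _ g; set b := marginal _ _; set c := marginal _ _.
  rewrite -subr_ge0 (_ : _ - _ = (2 * a - b - c) ^+ 2) ?sqr_ge0 //; ring.
have := step l; have := step (linv l); move: (\sum_g _) (\sum_g _) => u v; lra.
Qed.

(** The shift energies in [nash] are paid for by the dispersions at two successive times, hence by
    the energy lost in two steps. The constant is 64 (2k)^2. *)
Lemma energy_step f l1 l2 (r : nat) : (0 < r)%N ->
  (forall l g, 0 <= f l g) -> mass f = 1 ->
  injective (fun p : 'I_r * 'I_r => e l1 *+ 2 *+ p.1 + e l2 *+ 2 *+ p.2) ->
  energy f <= r%:R ^- 2 + (256 * k ^ 2)%:R * r%:R ^+ 2 *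
     (energy f - energy (transfer e (transfer e f))).
Proof.
move=> r0 f0 f1 inj; apply: le_trans (energy_le_marginal f0) _.
apply: le_trans (nash r0 _ f1 inj) _.
  by move=> g; apply: sumr_ge0 => l _; apply: f0.
rewrite lerD2l -mulrA mulrCA ler_wpM2l ?sqr_ge0 //.
have := shift_energy_marginal f l1; have := shift_energy_marginal f l2.
set D1 := shift_energy _ _; set D2 := shift_energy _ _.
have := energy_transfer e k2 f; have := energy_transfer e k2 (transfer e f).
set D := dispersion f + _; set d := dispersion f; set d' := dispersion (transfer _ _) in D *.
set E0 := energy f; set E1 := energy (transfer e f); set E2 := energy (transfer _ (transfer _ _)).
have d0 : 0 <= D by rewrite addr_ge0 ?dispersion_ge0.
set q : R := (2 * k).-1%:R; rewrite {1}/D.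
have kq : (2 * k)%:R = q + 1 :> R by rewrite /q -[1]/(1%:R) -natrD; congr _%:R; lia.
have q3 : 3 <= q by rewrite /q ler_nat; lia.
have -> : (256 * k ^ 2)%:R = 64 * (q + 1) ^+ 2 :> R.
  by rewrite -kq -natrX -natrM; congr _%:R; lia.
rewrite kq; clearbody q; move=> e12 e01 D2l D1l.
have -> : E0 - E2 = (q - 1) / (2 * q ^+ 2) * D.
  by rewrite /D mulrDr -e01 -e12; ring.
have q0 : q != 0 by rewrite gt_eqF // (lt_le_trans _ q3).
have -> : 64 * (q + 1) ^+ 2 * ((q - 1) / (2 * q ^+ 2) * D) =
  (32 * (q + 1) ^+ 2 * (q - 1) / q ^+ 2) * D by field.
apply: (@le_trans _ _ (16 * (q + 1) * D)); first by move: D1l D2l; rewrite -/D; lra.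
rewrite ler_wpM2r // ler_pdivlMr ?exprn_gt0 ?(lt_le_trans _ q3) //.
nra.
Qed.

(** With C = 256 k^2, going from scale J to J + 1 leaves exactly 2 * 96 C * 4^J more steps, the
    stretch summed in [energy_decay]. *)
Definition decay_time : nat := (2 * (32 * (256 * k ^ 2)))%N.

(* Induction on J: summing energy_step with r = 2^(J+1) over a stretch of time *)
(* of order 4^J, on which the energy is already O(1/4^J), telescopes.          *)
Lemma energy_decay f l1 l2 (J n : nat) :
  (forall l g, 0 <= f l g) -> mass f = 1 ->
  injective (fun p : 'I_(2 ^ J) * 'I_(2 ^ J) =>
    e l1 *+ 2 *+ p.1 + e l2 *+ 2 *+ p.2) ->
  (decay_time * 4 ^ J <= n)%N ->
  energy (iter n (transfer e) f) <= 2 / 4 ^+ J.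
Proof.
move=> f0 f1.
pose u m := iter m (transfer e) f; rewrite -/(u n).
have u0 m : forall l g, 0 <= u m l g.
  by elim: m => //= m IHm; apply: transfer_ge0.
have u1 m : mass (u m) = 1 by elim: m => //= m IHm; rewrite mass_transfer.
have uS m : energy (u m.+1) <= energy (u m) by apply: energy_transfer_le.
have uD m p : energy (u (m + p)%N) <= energy (u m).
  by elim: p => [|p IHp]; rewrite ?addn0 // addnS (le_trans (uS _)).
have mono m p : (m <= p)%N -> energy (u p) <= energy (u m).
  by move=> mp; rewrite -(subnKC mp).
elim: J n => [|J IHJ] n inj tn.
  apply: (@le_trans _ _ (energy f)); first exact: (mono 0).
  have fle l g : f l g <= 1.
    have mg h : 0 <= marginal f h by apply: sumr_ge0.
    by rewrite -f1 (le_trans _ (le_bigT g mg)) // (le_bigT (a := f^~ g)).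
  rewrite expr0 divr1; apply: (@le_trans _ _ 1); last by rewrite ler1n.
  rewrite -f1; apply: ler_sum => g _; apply: ler_sum => l _.
  by rewrite expr2 ler_piMr.
have {}IHJ : forall m, (decay_time * 4 ^ J <= m)%N -> energy (u m) <= 2 / 4 ^+ J.
  move=> m; apply: IHJ.
  have le2 : (2 ^ J <= 2 ^ J.+1)%N by rewrite leq_exp2l.
  move=> p p' pp'.
  have /inj[] : (fun p : 'I_(2 ^ J.+1) * 'I_(2 ^ J.+1) =>
       e l1 *+ 2 *+ p.1 + e l2 *+ 2 *+ p.2)
      (widen_ord le2 p.1, widen_ord le2 p.2) =
    (fun p : 'I_(2 ^ J.+1) * 'I_(2 ^ J.+1) =>
       e l1 *+ 2 *+ p.1 + e l2 *+ 2 *+ p.2)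
      (widen_ord le2 p'.1, widen_ord le2 p'.2) by [].
  case: p p' {pp'} => [a b] [a' b'] /= /val_inj/= ea /val_inj/= eb.
  by rewrite ea eb.
pose C := (256 * k ^ 2)%N.
pose m := (decay_time * 4 ^ J)%N; pose I := (3 * (32 * C) * 4 ^ J)%N.
have sum_le p : p%:R * energy (u (m + 2 * p)%N) <=
    p%:R * (2 ^ J.+1)%:R ^- 2 + C%:R * (2 ^ J.+1)%:R ^+ 2 *
      (energy (u m) - energy (u (m + 2 * p)%N)).
  elim: p => [|p IHp]; first by rewrite muln0 addn0 !mul0r subrr mulr0 addr0.
  have := energy_step (r := (2 ^ J.+1)%N) _ (u0 (m + 2 * p)%N) (u1 _) inj.
  rewrite expn_gt0 /= => /(_ isT).
  have -> : transfer e (transfer e (u (m + 2 * p)%N)) = u (m + 2 * p.+1)%N.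
    by rewrite mulnS addnCA.
  have := mono (m + 2 * p)%N (m + 2 * p.+1)%N _.
  rewrite leq_add2l leq_mul2l leqnSn orbT => /(_ isT).
  rewrite -/C.
  move: (energy (u m)) (energy (u (m + 2 * p)%N)) (energy (u (m + 2 * p.+1)%N)) IHp.
  move=> Em Ep Ep1; set X := _ ^- 2; set Y := C%:R * _ => IHp le1 le2.
  rewrite -(natr1 p).
  have p0 : 0 <= p%:R :> R by [].
  have : p%:R * Ep1 <= p%:R * Ep by rewrite ler_wpM2l.
  nra.
have k0 : (0 < k)%N by lia.
have C0 : (0 < C)%N by rewrite /C muln_gt0 expn_gt0 k0.
have Ile : (m + 2 * I <= n)%N.
  by apply: leq_trans tn; rewrite /m /I /decay_time -/C (expnS 4); lia.
apply: le_trans (mono _ _ Ile) _.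
have I0 : 0 < I%:R :> R by rewrite ltr0n /I -/C; lia.
rewrite -(ler_pM2l I0); apply: le_trans (sum_le I) _.
have Em := IHJ m (leqnn _); have E0 := energy_ge0 (u (m + 2 * I)%N).
have x0 : 0 < 4 ^+ J :> R by rewrite exprn_gt0.
have -> : (2 ^ J.+1)%:R ^+ 2 = 4 * 4 ^+ J :> R.
  by rewrite -natrX -expnM mulnC expnM natrX exprS.
have IE : I%:R = 96 * C%:R * 4 ^+ J :> R by rewrite -natrX -!natrM; congr _%:R; rewrite /I; lia.
have C0' : 0 < C%:R :> R by rewrite ltr0n.
have bnd : C%:R * (4 * 4 ^+ J) * (energy (u m) - energy (u (m + 2 * I)%N)) <=
     C%:R * (4 * 4 ^+ J) * (2 / 4 ^+ J).
  by rewrite ler_wpM2l ?mulr_ge0 // ?(ltW x0) // lerBlDr (le_trans Em) // lerDl.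
apply: le_trans (lerD (lexx _) bnd) _.
rewrite IE exprS; move: (4 ^+ J) x0 => x x0.
(* The box term gives 24 C and the telescoped drop 8 C, against 48 C allowed. *)
have -> : 96 * C%:R * x * (4 * x)^-1 + C%:R * (4 * x) * (2 / x) = 32 * C%:R.
  by field; rewrite gt_eqF.
have -> : 96 * C%:R * x * (2 / (4 * x)) = 48 * C%:R by field; rewrite gt_eqF.
by rewrite ler_pM2r // ler_nat.
Qed.

End Decay.

(** * Equidistribution in finite quotients *)

Lemma cvg0_sqr_le (R : realType) (a b : nat -> R) :
  (forall n, a n ^+ 2 <= b n) -> b n @[n --> \oo] --> (0 : R) ->
  a n @[n --> \oo] --> (0 : R).
Proof.
move=> ab /cvgr0Pnorm_lt b0; apply/cvgr0Pnorm_lt => eps eps0.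
have e20 : 0 < eps ^+ 2 by rewrite exprn_gt0.
near=> n.
rewrite -(ltr_pXn2r (n := 2)) ?nnegrE ?(ltW eps0) //.
rewrite real_normK ?num_real // (le_lt_trans (ab n)) //.
rewrite (le_lt_trans (ler_norm _)) //.
by near: n; exact: b0.
Unshelve. all: by end_near.
Qed.

Lemma cvgn_sum (R : realType) (I : Type) (r : seq I) (P : pred I)
    (F : I -> nat -> R) (a : I -> R) :
  (forall i, P i -> F i n @[n --> \oo] --> a i) ->
  \sum_(i <- r | P i) F i n @[n --> \oo] --> \sum_(i <- r | P i) a i.
Proof.
move=> Fa; elim: r => [|i r IHr].
  by rewrite big_nil; under eq_fun do rewrite big_nil; exact: cvg_cst.
rewrite big_cons; under eq_fun do rewrite big_cons.
by case: ifP => // Pi; apply: cvgD => //; exact: Fa.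
Qed.

Section Equidistribution.
Variables (R : realType) (k : nat) (G : finZmodType) (e : letter k -> G).
Hypotheses (k2 : (2 <= k)%N) (eV : forall l, e (linv l) = - e l).
Hypothesis e_gen : forall P : G -> Prop,
  P 0 -> (forall g l, P g -> P (g + e l)) -> forall g, P g.
Variable f : letter k -> G -> R.

Local Notation u n := (iter n (transfer e) f).

(** The energy is nonincreasing and bounded below, so its drops, proportional to the dispersion,
    tend to 0. *)
Lemma dispersion_cvg0 : dispersion (u n) @[n --> \oo] --> (0 : R).
Proof.
pose c : R := (2 * (2 * k).-1%:R ^+ 2) / ((2 * k).-1%:R - 1).
have -> : (fun n => dispersion (u n)) =
    (fun n => c * (energy (u n) - energy (u n.+1))).
  apply/funext => n; rewrite energy_transfer // /c; field.
  rewrite -[1]/(1%:R) -natrB ?pnatr_eq0; last lia.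
  by apply/andP; split; rewrite ?pnatr_eq0; lia.
have Ecvg : cvgn (fun n => energy (u n)).
  apply: nonincreasing_is_cvgn; last first.
    by exists 0 => _ [n _ <-]; apply: energy_ge0.
  by apply/nonincreasing_seqP => n; apply: energy_transfer_le.
rewrite -(mulr0 c) -(subrr (limn (fun n => energy (u n)))).
apply: cvgM; first exact: cvg_cst.
apply: cvgB; first exact: Ecvg.
by rewrite (cvg_shiftS (fun n => energy (u n))).
Qed.

Lemma marginal_step_cvg0 g l :
  marginal (u n.+1) g - marginal (u n) (g - e l) @[n --> \oo] --> (0 : R).
Proof.
apply: (cvg0_sqr_le (b := fun n =>
  2 * (2 * k)%:R * (dispersion (u n) + dispersion (u n.+1)))).
  move=> n; apply: le_trans (marginal_transfer_diff e k2 (u n) l).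
  apply: (le_bigT (a := fun g => (marginal (u n.+1) g - marginal (u n) (g - e l)) ^+ 2)).
  by move=> h; apply: sqr_ge0.
rewrite -(mulr0 (2 * (2 * k)%:R)) -(addr0 (0 : R)).
apply: cvgM; first exact: cvg_cst.
apply: cvgD; first exact: dispersion_cvg0.
by rewrite (cvg_shiftS (fun n => dispersion (u n))); exact: dispersion_cvg0.
Qed.

(** The marginal at time n + 1 is close to the marginal at time n one letter away, in every
    direction. The sum of two consecutive times is therefore asymptotically invariant under each
    letter, hence constant on G, and the mass fixes the constant. *)
Lemma equidistribution g :
  marginal (u n) g + marginal (u n.+1) g @[n --> \oo] --> 2 * mass f / #|G|%:R.
Proof.
pose v n h := marginal (u n) h + marginal (u n.+1) h.
have v0 h : v n g - v n h @[n --> \oo] --> (0 : R).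
  move: h; suff v0 h : v n g - v n (g + h) @[n --> \oo] --> (0 : R).
    by move=> h; rewrite -(subrK g h) addrC; apply: v0.
  elim/e_gen: h => [|h l IHh].
    by under eq_fun do rewrite addr0 subrr; exact: cvg_cst.
  have -> : (fun n => v n g - v n (g + (h + e l))) = (fun n =>
     (v n g - v n (g + h)) +
     ((marginal (u n.+1) (g + h) - marginal (u n) (g + h - e (linv l)))
     - (marginal (u n.+1) (g + h + e l) - marginal (u n) (g + h + e l - e l)))).
    by apply/funext => n; rewrite /v eV opprK addrK addrA; ring.
  rewrite -[X in _ --> X](addr0 (0 : R)); apply: cvgD; first exact: IHh.
  by rewrite -[X in _ --> X](subrr (0 : R)); apply: cvgB; exact: marginal_step_cvg0.
have G0 : #|G|%:R != 0 :> R.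
  by rewrite pnatr_eq0 -lt0n; apply/card_gt0P; exists 0.
have -> : (fun n => marginal (u n) g + marginal (u n.+1) g) = (fun n =>
    2 * mass f / #|G|%:R + #|G|%:R^-1 * \sum_h (v n g - v n h)).
  apply/funext => n.
  have massu m : mass (u m) = mass f by elim: m => //= m IHm; rewrite mass_transfer.
  have -> : \sum_h (v n g - v n h) = #|G|%:R * v n g - 2 * mass f.
    have -> : 2 * mass f = \sum_h v n h.
      rewrite /v big_split /= -[X in _ = X + _]/(mass (u n)).
      by rewrite -[X in _ = _ + X]/(mass (u n.+1)) !massu; ring.
    rewrite sumrB sumr_const.
    by rewrite -[_ *+ #|_|]mulr_natl.
  by rewrite /v; field.
rewrite -[X in _ --> X]addr0; apply: cvgD; first exact: cvg_cst.
rewrite -[X in _ --> X](mulr0 #|G|%:R^-1); apply: cvgM; first exact: cvg_cst.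
have := cvgn_sum (r := index_enum G) (fun h (_ : xpredT h) => v0 h).
by rewrite big1.
Qed.

End Equidistribution.

(** * Sums over reduced words *)

Section Words.
Variable k : nat.
Hypothesis k2 : (2 <= k)%N.
Implicit Types (l : letter k) (s u v : seq (letter k)).

Fixpoint rwords (n : nat) : seq (seq (letter k)) :=
  if n is m.+1 then
    [seq l :: s | l <- enum {: letter k}, s <- [seq s <- rwords m | reduced (l :: s)]]
  else [:: [::]].

Lemma reduced_cons2 l l' s :
  reduced (l :: l' :: s) = (l' != linv l) && reduced (l' :: s).
Proof. by []. Qed.

Lemma reduced_behead l s : reduced (l :: s) -> reduced s.
Proof. exact: path_sorted. Qed.

Lemma mem_rwords n s : (s \in rwords n) = (size s == n) && reduced s.
Proof.
elim: n s => [|n IHn] s; first by rewrite inE; case: s.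
apply/idP/idP => [/allpairsPdep[l [s' [_]]]|].
  by rewrite mem_filter IHn => /andP[rs /andP[/eqP <- _]] ->; rewrite eqxx rs.
case: s => // l s /andP[/= /eqP[sn] rs]; apply/allpairsPdep; exists l, s.
by rewrite mem_enum mem_filter rs IHn sn eqxx (reduced_behead rs).
Qed.

Lemma rwords_uniq n : uniq (rwords n).
Proof.
elim: n => //= n IHn; apply: allpairs_uniq_dep; rewrite ?enum_uniq //.
  by move=> l _; apply: filter_uniq.
by move=> [l s] [l' s'] _ _ /= [-> ->].
Qed.

Lemma sum_rwordsS (V : nmodType) n (phi : seq (letter k) -> V) :
  \sum_(s <- rwords n.+1) phi s =
  \sum_l \sum_(s <- rwords n | reduced (l :: s)) phi (l :: s).
Proof.
rewrite big_allpairs_dep /= -[in RHS]big_enum /=.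
by apply: eq_bigr => l _; rewrite big_filter.
Qed.

Lemma sum_rwords_after (V : nmodType) l n (phi : seq (letter k) -> V) :
  \sum_(s <- rwords n.+1 | reduced (l :: s)) phi s =
  \sum_(l' | l' != linv l) \sum_(s <- rwords n | reduced (l' :: s)) phi (l' :: s).
Proof.
rewrite big_mkcond sum_rwordsS [RHS]big_mkcond; apply: eq_bigr => l' _.
case: (boolP (l' != linv l)) => ll'; first last.
  by rewrite big1 // => s _; rewrite reduced_cons2 (negPf ll').
by apply: eq_bigr => s rs; rewrite reduced_cons2 ll' rs.
Qed.

Lemma card_neq_letter l : #|[pred l' | l' != l]| = (2 * k).-1.
Proof. by rewrite cardC1 card_letter. Qed.

Section Sums.
Variable R : realFieldType.
Implicit Types (phi psi : seq (letter k) -> R).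

Let q : R := (2 * k).-1%:R.

Lemma count_after l n :
  \sum_(s <- rwords n | reduced (l :: s)) (1 : R) = q ^+ n.
Proof.
elim: n l => [|n IHn] l; first by rewrite big_mkcond big_seq1.
rewrite sum_rwords_after; under eq_bigr do rewrite IHn.
rewrite sumr_const (_ : #|_| = (2 * k).-1); first by rewrite -mulr_natl exprS.
exact: card_neq_letter.
Qed.

Lemma size_rwordsS n : (size (rwords n.+1))%:R = (2 * k)%:R * q ^+ n.
Proof.
have -> : (size (rwords n.+1))%:R = \sum_(s <- rwords n.+1) (1 : R).
  by rewrite big_const_seq count_predT iter_addr addr0.
rewrite sum_rwordsS; under eq_bigr do rewrite count_after.
by rewrite sumr_const card_letter -[_ *+ (2 * k)]mulr_natl.
Qed.

Lemma size_rwords_gt0 n : 0 < (size (rwords n))%:R :> R.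
Proof.
case: n => [|n]; first by rewrite ltr01.
by rewrite size_rwordsS mulr_gt0 ?exprn_gt0 // ltr0n; lia.
Qed.

(** A reduced word splits into two reduced words; pairs that cancel at the junction only add
    nonnegative terms. *)
Lemma sum_rwords_cat n m phi : (forall s, 0 <= phi s) ->
  \sum_(s <- rwords (n + m)) phi s <=
  \sum_(u <- rwords n) \sum_(v <- rwords m) phi (u ++ v).
Proof.
elim: n phi => [|n IHn] phi phi0; first by rewrite big_seq1.
rewrite addSn !sum_rwordsS; apply: ler_sum => l _.
rewrite big_mkcond; apply: le_trans (IHn _ _) _ => /=.
  by move=> s; case: ifP.
rewrite [leRHS]big_mkcond; apply: ler_sum => u _.
case: ifPn => lu; first by apply: ler_sum => v _; case: ifP.
rewrite big1 // => v _; case: ifPn => // luv; case/negP: lu.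
by move: luv; rewrite /reduced /= cat_path => /andP[].
Qed.

Definition wmean phi n : R := (\sum_(s <- rwords n) phi s) / (size (rwords n))%:R.

Lemma wmean_le phi psi n : (forall s, size s = n -> phi s <= psi s) ->
  wmean phi n <= wmean psi n.
Proof.
move=> le_phi; rewrite ler_pM2r ?invr_gt0 ?size_rwords_gt0 //.
rewrite big_seq [leRHS]big_seq; apply: ler_sum => s.
by rewrite mem_rwords => /andP[/eqP + _]; apply: le_phi.
Qed.

Lemma wmean_sum (I : Type) (r : seq I) (P : pred I) (F : I -> seq (letter k) -> R) n :
  wmean (fun s => \sum_(i <- r | P i) F i s) n = \sum_(i <- r | P i) wmean (F i) n.
Proof. by rewrite /wmean exchange_big mulr_suml. Qed.

Lemma wmeanZ a phi n : wmean (fun s => a * phi s) n = a * wmean phi n.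
Proof. by rewrite /wmean -mulr_sumr mulrA. Qed.

Lemma wmeanD phi psi n :
  wmean (fun s => phi s + psi s) n = wmean phi n + wmean psi n.
Proof. by rewrite /wmean big_split mulrDl. Qed.

Lemma wmean_cst a n : wmean (fun=> a) n = a.
Proof.
rewrite /wmean big_const_seq count_predT iter_addr addr0 -[a *+ _]mulr_natr.
by rewrite mulfK // gt_eqF // size_rwords_gt0.
Qed.

Lemma eq_wmean phi psi n : (forall s, size s = n -> phi s = psi s) ->
  wmean phi n = wmean psi n.
Proof.
by move=> E; apply: le_anti; rewrite !wmean_le // => s /E ->.
Qed.

Section Image.
Variables (G : finZmodType) (e : letter k -> G).
Hypothesis eV : forall l, e (linv l) = - e l.

Definition wimage s : G := \sum_(l <- s) e l.
(** The law of a one-letter word, so that n iterations of [transfer] describe words of length n +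
    1. *)
Definition walk0 l (g : G) : R := (g == e l)%:R / (2 * k)%:R.

Local Notation mu n := (iter n (transfer e) walk0).

Let N0 : (2 * k)%:R != 0 :> R.
Proof. by rewrite pnatr_eq0; lia. Qed.

Let q0 : q != 0.
Proof. by rewrite pnatr_eq0; lia. Qed.

Lemma walk0_ge0 l g : 0 <= walk0 l g.
Proof. by rewrite divr_ge0. Qed.

Lemma mass_walk0 : mass walk0 = 1.
Proof.
rewrite /mass /marginal exchange_big /=.
under eq_bigr => l _.
  rewrite -mulr_suml (bigD1 (e l)) //= eqxx big1 ?addr0; first over.
  by move=> g /negPf ->.
by rewrite sumr_const card_letter -[_ *+ (2 * k)]mulr_natl div1r mulfV.
Qed.

Lemma count_image_after l n g :
  \sum_(s <- rwords n | reduced (l :: s)) (wimage (l :: s) == g)%:R =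
  (2 * k)%:R * q ^+ n * mu n l g :> R.
Proof.
elim: n l g => [|n IHn] l g.
  rewrite big_mkcond big_seq1 /= /wimage big_seq1 expr0 mulr1 /walk0 eq_sym.
  by rewrite mulrC divfK.
rewrite sum_rwords_after.
under eq_bigr => l' _.
  under eq_bigr => s _ do
    rewrite {1}/wimage big_cons -/(wimage _) eq_sym addrC -subr_eq eq_sym.
  rewrite IHn; over.
rewrite -mulr_sumr /= /transfer exprS -/q; field.
exact: q0.
Qed.

Lemma wmean_image n g :
  wmean (fun s => (wimage s == g)%:R) n.+1 = marginal (mu n) g.
Proof.
rewrite /wmean sum_rwordsS; under eq_bigr do rewrite count_image_after.
rewrite -mulr_sumr size_rwordsS mulrC mulKf // mulf_neq0 ?expf_neq0 //.
Qed.

(* Cut the word in two pieces and apply Cauchy-Schwarz.                       *)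
Lemma wmean_return_le a b :
  wmean (fun s => (wimage s == 0)%:R) (a.+1 + b.+1) <=
  (2 * k)%:R * (energy (mu a) + energy (mu b)).
Proof.
have countE n g : \sum_(s <- rwords n.+1) (wimage s == g)%:R =
    (2 * k)%:R * q ^+ n * marginal (mu n) g.
  rewrite -wmean_image /wmean size_rwordsS mulrC divfK //.
  by rewrite mulf_neq0 ?expf_neq0.
have q_gt0 : 0 < q by rewrite ltr0n; lia.
have N_gt0 : 0 < (2 * k)%:R :> R by rewrite ltr0n; lia.
rewrite /wmean ler_pdivrMr ?size_rwords_gt0 //.
apply: le_trans (sum_rwords_cat _ _ _) _ => //.
have -> : \sum_(u <- rwords a.+1) \sum_(v <- rwords b.+1) (wimage (u ++ v) == 0)%:R =
  (2 * k)%:R ^+ 2 * q ^+ (a + b) * \sum_g marginal (mu a) g * marginal (mu b) (- g).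
  transitivity (\sum_(u <- rwords a.+1) \sum_g (wimage u == g)%:R *
      ((2 * k)%:R * q ^+ b * marginal (mu b) (- g))).
    apply: eq_bigr => u _; rewrite (bigD1 (wimage u)) //= eqxx mul1r -countE.
    rewrite [X in _ = _ + X]big1 => [|g]; last by rewrite eq_sym => /negPf ->; rewrite mul0r.
    rewrite addr0; apply: eq_bigr => v _.
    by rewrite /wimage big_cat /= addrC addr_eq0.
  rewrite exchange_big mulr_sumr; apply: eq_bigr => g _ /=.
  by rewrite -mulr_suml countE exprD; ring.
have -> : (size (rwords (a.+1 + b.+1)))%:R = (2 * k)%:R * q ^+ (a + b) * q.
  by rewrite addSn size_rwordsS addnS exprSr mulrA.
have M_le : \sum_g marginal (mu a) g * marginal (mu b) (- g) <=
    (2 * k)%:R / 2 * (energy (mu a) + energy (mu b)).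
  apply: (@le_trans _ _ ((\sum_g marginal (mu a) g ^+ 2 + \sum_g marginal (mu b) g ^+ 2) / 2)).
    rewrite [X in _ + X](reindex_inj (@oppr_inj G)) -big_split mulr_suml /=.
    apply: ler_sum => g _; set x := marginal _ _; set y := marginal _ _.
    by have := sqr_ge0 (x - y); rewrite sqrrB; lra.
  have := marginal_le_energy (mu a); have := marginal_le_energy (mu b).
  move: (\sum_g _) (\sum_g _) (energy _) (energy _) => x y z t; lra.
(* Forgetting the junction condition costs a factor 2k / q <= 2, absorbed by the 1/2 in [M_le]. *)
have Nq : (2 * k)%:R <= 2 * q by rewrite /q -natrM ler_nat; lia.
have E0 : 0 <= energy (mu a) + energy (mu b) by rewrite addr_ge0 ?energy_ge0.
apply: le_trans (ler_wpM2l _ M_le) _.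
  by rewrite mulr_ge0 ?exprn_ge0 // ltW.
have := exprn_gt0 (a + b) q_gt0; move: (q ^+ (a + b)) => Q Q0.
move: (_ + _) E0 N_gt0 Nq => E E0; move: (2 * k)%:R => N' N_gt0 Nq.
have -> : N' ^+ 2 * Q * (N' / 2 * E) = (N' ^+ 2 * Q * E / 2) * N' by ring.
have -> : N' * E * (N' * Q * q) = (N' ^+ 2 * Q * E / 2) * (2 * q) by field.
by rewrite ler_wpM2l // !mulr_ge0 ?exprn_ge0 ?invr_ge0 // ltW.
Qed.

End Image.

(** * Second moment of an additive function of a random reduced word *)

Section SecondMoment.
Variable c : letter k -> R.
Hypothesis cV : forall l, c (linv l) = - c l.

Let x s : R := \sum_(l <- s) c l.

Let sum_c : \sum_l c l = 0.
Proof.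
have : \sum_l c l = - \sum_l c l.
  by rewrite {1}(reindex_inj (@linv_inj k)) -sumrN; apply: eq_bigr => l _.
by move=> /eqP; rewrite -subr_eq0 opprK -mulr2n mulrn_eq0 => /eqP.
Qed.

(** As [c] sums to 0, its sum over the letters allowed after [l] is c l. The drift thus decays
    geometrically, and the factor q - 1 clears the geometric series. *)
Lemma first_moment_after l n :
  (q - 1) * \sum_(s <- rwords n | reduced (l :: s)) x s = (q ^+ n - 1) * c l.
Proof.
elim: n l => [|n IHn] l.
  by rewrite big_mkcond big_seq1 /x big_nil expr0 subrr mulr0 mul0r.
rewrite sum_rwords_after mulr_sumr.
have E l' : (q - 1) * \sum_(s <- rwords n | reduced (l' :: s)) x (l' :: s) =
    (q ^+ n.+1 - 1) * c l'.
  under eq_bigr => s _ do rewrite /x big_cons -/(x s) -[c l']mulr1.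
  by rewrite big_split /= -mulr_sumr count_after mulrDr IHn exprS; ring.
under eq_bigr do rewrite E.
rewrite -mulr_sumr; congr (_ * _); apply/eqP.
have := sum_c; rewrite (bigD1 (linv l)) //= cV => /eqP.
by rewrite addrC subr_eq0.
Qed.

(** Prepending a letter adds a square and a cross term known from [first_moment_after]; as q >= 3,
    they total at most 2 c(l)^2 q^n, whence linear growth. *)
Lemma second_moment n :
  wmean (fun s => x s ^+ 2) n <= 2 * n%:R / (2 * k)%:R * \sum_l c l ^+ 2.
Proof.
set V := \sum_l _.
have V0 : 0 <= V by apply: sumr_ge0 => l _; apply: sqr_ge0.
have q3 : 3 <= q by rewrite ler_nat; lia.
have q_gt0 : 0 < q by apply: lt_le_trans q3.
have bound : q * \sum_(s <- rwords n) x s ^+ 2 <= 2 * V * n%:R * q ^+ n.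
  elim: n => [|n IHn].
    by rewrite big_seq1 /x big_nil expr0n !mulr0 mul0r.
  rewrite sum_rwordsS.
  have -> : \sum_l \sum_(s <- rwords n | reduced (l :: s)) x (l :: s) ^+ 2 =
     \sum_l (c l ^+ 2 * q ^+ n + 2 * c l * \sum_(s <- rwords n | reduced (l :: s)) x s)
     + \sum_l \sum_(s <- rwords n | reduced (l :: s)) x s ^+ 2.
    rewrite -big_split; apply: eq_bigr => l _ /=.
    rewrite -(count_after l n) !mulr_sumr -!big_split /=.
    by apply: eq_bigr => s _; rewrite /x big_cons -/(x s); ring.
  have le1 : \sum_l (c l ^+ 2 * q ^+ n +
      2 * c l * \sum_(s <- rwords n | reduced (l :: s)) x s) <= 2 * V * q ^+ n.
    rewrite -mulrA mulr_suml mulr_sumr; apply: ler_sum => l _.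
    rewrite -(ler_pM2l (_ : 0 < q - 1)); last first.
      by rewrite subr_gt0 (lt_le_trans _ q3) // ltr1n.
    rewrite mulrDr [X in _ + X](_ : _ = 2 * c l * ((q ^+ n - 1) * c l)); last first.
      by rewrite -first_moment_after; ring.
    have : 1 <= q ^+ n by rewrite exprn_ege1 // (le_trans _ q3) // ler1n.
    have := sqr_ge0 (c l); rewrite -(first_moment_after l n) !first_moment_after.
    move: (q ^+ n) (c l) => Q y y0 Q1.
    have : 0 <= y ^+ 2 * Q by rewrite mulr_ge0 // (le_trans _ Q1).
    move: q q3 {q_gt0 IHn} => q' q3; nra.
  (* A nonempty word can be preceded by q letters; the empty one by 2k, but there [x] vanishes. *)
  have le2 : \sum_l \sum_(s <- rwords n | reduced (l :: s)) x s ^+ 2 <=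
      q * \sum_(s <- rwords n) x s ^+ 2.
    under eq_bigr do rewrite big_mkcond.
    rewrite exchange_big mulr_sumr /=; apply: ler_sum => -[|l' s] _.
      by rewrite /x big_nil expr0n mulr0 big1 // => l _; case: ifP.
    apply: (@le_trans _ _ (\sum_(l | l != linv l') x (l' :: s) ^+ 2)).
      rewrite [leRHS]big_mkcond; apply: ler_sum => l _.
      have -> : (l != linv l') = (l' != linv l) by rewrite eq_sym (inv_eq (@linvK k)).
      rewrite /=; case: (l' != linv l) => //=; case: ifP => // _; exact: sqr_ge0.
    rewrite sumr_const (_ : #|_| = (2 * k).-1); first by rewrite -[leLHS]mulr_natl.
    exact: card_neq_letter.
  rewrite exprS -natr1.
  have := ler_wpM2l (ltW q_gt0) (lerD le1 (le_trans le2 IHn)).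
  by move: (q ^+ n) => Q; lra.
rewrite /wmean; case: n bound => [|n] bound.
  by rewrite big_seq1 /x big_nil expr0n !(mul0r, mulr0).
rewrite ler_pdivrMr ?size_rwords_gt0 // size_rwordsS.
rewrite -(ler_pM2l q_gt0); apply: le_trans bound _.
rewrite exprS le_eqVlt; apply/orP; left; apply/eqP; field.
by rewrite pnatr_eq0; lia.
Qed.

End SecondMoment.

End Sums.

End Words.

(** * Divisibility and tightness of the gcd *)

Section Residues.
Variable k : nat.
Hypothesis k2 : (2 <= k)%N.
Implicit Types (l : letter k) (s : seq (letter k)).

Definition abel_word s : 'rV[int]_k := \sum_(l <- s) (-1) ^+ l.2 *: delta_mx 0 l.1.

Definition wgcd s : nat := gcd_coords (abel_word s).

Definition exponent i l : int := if l.1 == i then (-1) ^+ l.2 else 0.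

Lemma abel_wordE s i : abel_word s 0 i = \sum_(l <- s) exponent i l.
Proof.
rewrite summxE; apply: eq_bigr => l _; rewrite !mxE /exponent eqxx /= eq_sym.
by case: eqP; rewrite ?mulr1 ?mulr0.
Qed.

Lemma exponent_linv i l : exponent i (linv l) = - exponent i l.
Proof.
rewrite /exponent /=; case: eqP => _; last by rewrite oppr0.
by case: l.2; rewrite ?opprK.
Qed.

Definition residue d l : 'rV['I_d.+1]_k := \row_i (Zp1 *~ exponent i l).

Lemma residue_linv d l : residue d (linv l) = - residue d l.
Proof. by apply/rowP => i; rewrite !mxE exponent_linv mulrNz. Qed.

Lemma Zp1_mulz_eq0 d (z : int) : (Zp1 *~ z == 0 :> 'I_d.+1) = (d.+1 %| `|z|)%N.
Proof.
have natE n : (Zp1 *+ n == 0 :> 'I_d.+1) = (d.+1 %| n)%N.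
  by rewrite Zp_mulrn -val_eqE /= modnMml mul1n.
by case: z => n; rewrite ?NegzE ?mulrNz ?oppr_eq0 ?abszN natE.
Qed.

Lemma wimage_residue d s : (wimage (residue d) s == 0) = (d.+1 %| wgcd s)%N.
Proof.
have E i : wimage (residue d) s 0 i = Zp1 *~ abel_word s 0 i.
  by rewrite abel_wordE mulrz_sumr summxE; apply: eq_bigr => l _; rewrite mxE.
apply/eqP/dvdn_biggcdP => [s0 i _|dv].
  by rewrite -Zp1_mulz_eq0 -E s0 mxE.
by apply/rowP => i; rewrite E mxE; apply/eqP; rewrite Zp1_mulz_eq0 dv.
Qed.

Lemma residue_gen d (P : 'rV['I_d.+1]_k -> Prop) :
  P 0 -> (forall g l, P g -> P (g + residue d l)) -> forall g, P g.
Proof.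
move=> P0 PD g.
have -> : g = \sum_i residue d (i, false) *+ g 0 i.
  apply/rowP => j; rewrite summxE (bigD1 j) //= big1 => [|i /negPf ij].
    rewrite addr0 mulmxnE mxE /exponent /= eqxx expr0 Zp_mulrn.
    by apply: val_inj; rewrite /= modnMml mul1n modn_small.
  by rewrite mulmxnE mxE /exponent /= ij mul0rn.
elim: (index_enum _) => [|i r IHr]; first by rewrite big_nil.
rewrite big_cons addrC; elim: (nat_of_ord _) => [|n IHn]; first by rewrite addr0.
by rewrite mulrSr addrA; apply: PD.
Qed.

(** The doubled coordinates stay below the modulus, so nothing wraps around. *)
Lemma residue_box_inj d (i1 i2 : 'I_k) (r : nat) : i1 != i2 -> (2 * r <= d.+1)%N ->
  injective (fun p : 'I_r * 'I_r =>
    residue d (i1, false) *+ 2 *+ p.1 + residue d (i2, false) *+ 2 *+ p.2).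
Proof.
move=> ne rd; have ltd (a : 'I_r) : (2 * a < d.+1)%N by have := ltn_ord a; lia.
have valE (a : 'I_r) : val (Zp1 *+ (2 * a) : 'I_d.+1) = (2 * a)%N.
  by rewrite Zp_mulrn /= modnMml mul1n modn_small.
move=> [a b] [a' b'] /= /rowP eq_ab.
have := eq_ab i1; have := eq_ab i2.
rewrite !mxE !mulmxnE !mxE /exponent /= !eqxx (eq_sym i2) (negPf ne).
rewrite !mul0rn !(add0r, addr0) -!mulrnA !mul1n.
move=> /(congr1 val) + /(congr1 val); rewrite !valE => eb ea.
by congr (_, _); apply: val_inj => /=; lia.
Qed.

End Residues.

(** Telescoping of (d + 1)^-2 <= 1/d - 1/(d + 1). *)
Lemma sum_inv_sqr_le (R : realFieldType) (D B : nat) : (0 < D)%N ->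
  \sum_(D.+1 <= d < B.+1) d%:R ^- 2 <= D%:R^-1 :> R.
Proof.
move=> D0; have [BD|DB] := leqP B D.
  by rewrite big_geq // invr_ge0.
apply: (@le_trans _ _ (\sum_(D <= d < B) (- d.+1%:R^-1 - - d%:R^-1))).
  rewrite big_add1 /= big_nat [leRHS]big_nat; apply: ler_sum => d /andP[Dd _].
  have d0 : 0 < d%:R :> R by rewrite ltr0n; lia.
  rewrite opprK addrC -natr1 -subr_ge0.
  have -> : d%:R^-1 - (d%:R + 1)^-1 - (d%:R + 1) ^- 2 = (d%:R * (d%:R + 1) ^+ 2)^-1 :> R.
    field; rewrite !gt_eqF //; lra.
  by rewrite invr_ge0 mulr_ge0 ?sqr_ge0 // ltW.
by rewrite telescope_sumr ?(ltnW DB) // opprK addrC lerBlDr lerDl invr_ge0.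
Qed.

Section Divisibility.
Variables (R : realType) (k : nat).
Hypothesis k2 : (2 <= k)%N.
Implicit Types (s : seq (letter k)).

Definition div_prob (d : nat) : nat -> R :=
  wmean (fun s : seq (letter k) => (d %| wgcd s)%N%:R).

Lemma div_prob_cvg d : (0 < d)%N ->
  div_prob d n + div_prob d n.+1 @[n --> \oo] --> (2 / d%:R ^+ k : R).
Proof.
case: d => // d _; rewrite -cvg_shiftS.
have divE n : div_prob d.+1 n.+1 =
    marginal (iter n (transfer (@residue k d)) (walk0 R (@residue k d))) 0.
  rewrite /div_prob -(wmean_image k2); apply: (eq_wmean k2) => s _; by rewrite wimage_residue.
under eq_fun do rewrite !divE.
have := equidistribution k2 (@residue_linv k d) (@residue_gen k d) (f := walk0 R (@residue k d)) 0.
by rewrite mass_walk0 // mulr1 card_mx card_ord mul1n natrX.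
Qed.

(** Both halves of the word are long enough for [energy_decay] at scale J, and the box of side 2^J
    fits modulo d. *)
Lemma div_prob_dyadic d J n : (2 ^ J.+1 <= d)%N ->
  (2 * (decay_time k * 4 ^ J) + 3 <= n)%N -> div_prob d n <= (8 * k)%:R / 4 ^+ J.
Proof.
case: d => [|d]; first by rewrite leqn0 expn_eq0.
move=> Jd tn.
have -> : n = (n.-2./2.+1 + (n.-2 - n.-2./2).+1)%N by lia.
set a := n.-2./2; set b := (n.-2 - a)%N.
rewrite /div_prob (eq_wmean k2 (psi := fun s => (wimage (@residue k d) s == 0)%:R)) //; last first.
  by move=> s _; rewrite wimage_residue.
apply: le_trans (wmean_return_le k2 R (@residue k d) a b) _.
pose i1 : 'I_k := Ordinal (ltnW k2); pose i2 : 'I_k := Ordinal k2.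
have decay m : (decay_time k * 4 ^ J <= m)%N ->
    energy (iter m (transfer (@residue k d)) (walk0 R (@residue k d))) <= 2 / 4 ^+ J.
  apply: (@energy_decay _ _ _ _ _ _ _ (i1, false) (i2, false)) => //.
  - exact: residue_linv.
  - exact: walk0_ge0.
  - exact: mass_walk0.
  - by apply: residue_box_inj => //; rewrite -expnS.
have Ea := decay a ltac:(lia); have Eb := decay b ltac:(lia).
apply: le_trans (ler_wpM2l _ (lerD Ea Eb)) _ => //.
rewrite -mulrDl mulrA ler_pM2r ?invr_gt0 ?exprn_gt0 // -natrD -natrM ler_nat; lia.
Qed.

Definition div_const : nat := (8 * k * (8 * decay_time k + 19))%N.

(** The largest scale J admissible in [div_prob_dyadic] is used. Scale J + 1 fails either because d
    < 2^(J+2), giving 16 / d^2, or because n is too short, giving a multiple of 1/n; [8 * A + 19]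
    dominates both constants. *)
Lemma div_prob_le d n : (2 <= d)%N -> (2 * decay_time k + 3 <= n)%N ->
  div_prob d n <= div_const%:R * (d%:R ^- 2 + n%:R^-1).
Proof.
move=> d2 tn; set A := decay_time k in tn *.
pose P J := (2 ^ J.+1 <= d)%N && (2 * (A * 4 ^ J) + 3 <= n)%N.
have exP : exists J, P J by exists 0%N; rewrite /P d2 muln1 tn.
have ubP J : P J -> (J <= d)%N.
  by move=> /andP[+ _]; rewrite expnS; have := ltn_expl J (isT : (1 < 2)%N); lia.
case: (ex_maxnP exP ubP) => J /andP[Jd Jn] maxJ.
apply: le_trans (div_prob_dyadic Jd Jn) _.
have x0 : 0 < 4 ^+ J :> R by rewrite exprn_gt0.
have d0 : 0 < d%:R :> R by rewrite ltr0n; lia.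
have n0 : 0 < n%:R :> R by rewrite ltr0n; lia.
have -> : div_const%:R = (8 * k)%:R * (8 * A + 19)%:R :> R by rewrite -natrM.
rewrite -mulrA ler_wpM2l //.
have : ~~ P J.+1 by apply/negP => /maxJ; rewrite ltnn.
rewrite negb_and -!ltnNge => /orP[lt_d|lt_n].
  apply: (@le_trans _ _ (16 * d%:R ^- 2)).
    rewrite ler_pdivlMr ?exprn_gt0 // mulrC ler_pdivrMr //.
    rewrite -!natrX -natrM ler_nat.
    have : (d * d <= (2 ^ J.+2) * (2 ^ J.+2))%N by rewrite leq_mul // ltnW.
    rewrite -expnD (_ : (J.+2 + J.+2 = 2 * J + 4)%N); last lia.
    by rewrite expnD expnM mulnn mulnC.
  rewrite mulrDr ler_wpDr ?mulr_ge0 ?invr_ge0 ?(ltW n0) //.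
  by rewrite ler_wpM2r ?invr_ge0 ?exprn_ge0 ?(ltW d0) // ler_nat; lia.
apply: (@le_trans _ _ ((8 * A + 19)%:R / n%:R)).
  rewrite ler_pdivlMr // mulrC ler_pdivrMr //.
  rewrite -!natrX -natrM ler_nat; move: lt_n; rewrite expnS.
  have : (0 < 4 ^ J)%N by rewrite expn_gt0.
  nia.
by rewrite ler_wpM2l // ler_wpDl ?invr_ge0 ?exprn_ge0 ?(ltW d0).
Qed.

Lemma wmean_abel_sqr n :
  wmean (fun s : seq (letter k) => \sum_i (abel_word s 0 i)%:~R ^+ 2) n <= 2 * n%:R :> R.
Proof.
rewrite wmean_sum.
apply: (@le_trans _ _ (\sum_(i < k) 2 * n%:R / k%:R)).
  apply: ler_sum => i _; pose c l : R := (exponent i l)%:~R.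
  have cV l : c (linv l) = - c l by rewrite /c exponent_linv mulrNz.
  rewrite (eq_wmean k2 (psi := fun s => (\sum_(l <- s) c l) ^+ 2)) //; last first.
    by move=> s _; rewrite abel_wordE /c -(rmorph_sum intr).
  apply: le_trans (second_moment k2 cV n) _.
  have -> : \sum_l c l ^+ 2 = 2.
    rewrite -(pair_bigA _ (fun j b => c (j, b) ^+ 2)) /= (bigD1 i) //= [X in _ + X]big1 => [|j /negPf ji].
      by rewrite big_bool /c /exponent /= eqxx !rmorphXn /= -!exprM /= expr2; lra.
    by rewrite big1 // => b _; rewrite /c /exponent /= ji expr0n.
  rewrite le_eqVlt; apply/orP; left; apply/eqP; rewrite natrM; field.
  by rewrite pnatr_eq0; lia.
rewrite sumr_const card_ord -[_ *+ k]mulr_natl mulrC divfK //.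
by rewrite pnatr_eq0; lia.
Qed.

Lemma wgcd_sqr_le s : (wgcd s)%:R ^+ 2 <= \sum_i (abel_word s 0 i)%:~R ^+ 2 :> R.
Proof.
have [->|g0] := eqVneq (wgcd s) 0%N.
  by rewrite expr0n; apply: sumr_ge0 => i _; apply: sqr_ge0.
have [i i0] : exists i, abel_word s 0 i != 0.
  apply/existsP; apply: contraNT g0; rewrite negb_exists => /forallP z.
  rewrite /wgcd /gcd_coords big1 // => i _.
  by have := z i; rewrite negbK => /eqP ->.
apply: (@le_trans _ _ ((abel_word s 0 i)%:~R ^+ 2)); last first.
  apply: (le_bigT (a := fun i => (abel_word s 0 i)%:~R ^+ 2)) => j; exact: sqr_ge0.
rewrite -[leRHS]real_normK ?num_real // -intr_norm lerXn2r ?nnegrE //.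
rewrite -abszE ler_nat dvdn_leq ?absz_gt0 //.
exact: biggcdn_inf.
Qed.

Definition gcd_tail (D : nat) : nat -> R :=
  wmean (fun s : seq (letter k) => (D < wgcd s)%N%:R).

(** A gcd in (D, B] is itself one of the divisors in a union bound; a gcd above B is handled by
    Chebyshev, as it is at most the absolute value of a nonzero coordinate. *)
Lemma gcd_tail_le (D B n : nat) : (0 < D)%N -> (0 < B)%N ->
  (2 * decay_time k + 3 <= n)%N ->
  gcd_tail D n <=
    div_const%:R * (D%:R^-1 + B%:R / n%:R) + 2 * n%:R / B%:R ^+ 2.
Proof.
move=> D0 B0 tn; have B0' : 0 < B%:R :> R by rewrite ltr0n.
apply: (@le_trans _ _ (wmean (fun s => \sum_(D.+1 <= d < B.+1) (d %| wgcd s)%N%:R +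
    B%:R ^- 2 * \sum_i (abel_word s 0 i)%:~R ^+ 2) n)).
  apply: wmean_le => // s _.
  have sq0 : 0 <= B%:R ^- 2 * \sum_i (abel_word s 0 i)%:~R ^+ 2 :> R.
    by rewrite mulr_ge0 ?invr_ge0 ?sqr_ge0 // sumr_ge0 // => i _; apply: sqr_ge0.
  have [Dg|_] := ltnP; last by rewrite addr_ge0 // sumr_ge0.
  have [gB|Bg] := leqP (wgcd s) B.
    rewrite (bigD1_seq (wgcd s)) ?iota_uniq ?mem_index_iota ?Dg //= dvdnn.
    by rewrite -addrA lerDl addr_ge0 // sumr_ge0.
  apply: (@le_trans _ _ (B%:R ^- 2 * \sum_i (abel_word s 0 i)%:~R ^+ 2)).
    rewrite mulrC ler_pdivlMr ?exprn_gt0 // mul1r.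
    apply: le_trans (wgcd_sqr_le s); rewrite lerXn2r ?nnegrE // ler_nat ltnW //.
  by rewrite lerDr sumr_ge0.
rewrite wmeanD wmeanZ wmean_sum; apply: lerD; last first.
  by rewrite mulrC ler_pM2r ?invr_gt0 ?exprn_gt0 // wmean_abel_sqr.
apply: (@le_trans _ _ (\sum_(D.+1 <= d < B.+1) div_const%:R * (d%:R ^- 2 + n%:R^-1))).
  rewrite big_nat [leRHS]big_nat; apply: ler_sum => d /andP[Dd _].
  by apply: div_prob_le => //; lia.
rewrite -mulr_sumr ler_wpM2l // big_split /= lerD ?sum_inv_sqr_le //.
by rewrite sumr_const_nat -[leLHS]mulr_natl ler_pM2r ?invr_gt0 ?ltr0n ?ler_nat //; lia.
Qed.

Lemma gcd_tail_small (eps : R) : 0 < eps ->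
  exists D, \forall n \near \oo, gcd_tail D n <= eps.
Proof.
move=> eps0; set C : R := div_const%:R.
have C0 : 0 <= C by [].
pose D := (Num.truncn (2 * C / eps)).+1.
have D_le : C / D%:R <= eps / 2.
  have : 2 * C / eps < D%:R by rewrite truncnS_gt.
  rewrite ltr_pdivrMr // => h.
  by rewrite ler_pdivrMr ?ltr0n // mulrAC ler_pdivlMr //; lra.
pose s0 := (Num.truncn (2 * (C + 32) / eps)).+1.
exists D; exists (maxn (s0 ^ 4) (2 * decay_time k + 3)) => // n /=.
rewrite geq_max => /andP[s0n tn].
(* With m ~ n^(1/4), apply gcd_tail_le to B = m^3, so that B / n and n / B^2   *)
(* both tend to 0.                                                             *)
pose P m := (m ^ 4 <= n)%N.
have ubP m : P m -> (m <= n)%N.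
  apply: leq_trans; case: m => // m; rewrite -[leqLHS]expn1; exact: leq_pexp2l.
case: (@ex_maxnP P n (ex_intro _ s0 s0n) ubP) => m mn maxm.
have s0m : (s0 <= m)%N by apply: maxm.
have m_gt0 : (0 < m)%N by apply: leq_trans s0m.
have nm : (n < m.+1 ^ 4)%N by rewrite ltnNge; apply/negP => /maxm; rewrite ltnn.
have m3 : (0 < m ^ 3)%N by rewrite expn_gt0 m_gt0.
apply: le_trans (gcd_tail_le _ m3 tn) _ => //.
have mR : 0 < m%:R :> R by rewrite ltr0n.
have nR : 0 < n%:R :> R by rewrite ltr0n; lia.
have le1 : (m ^ 3)%:R / n%:R <= m%:R^-1 :> R.
  rewrite ler_pdivrMr // mulrC ler_pdivlMr // -natrM ler_nat.
  by rewrite mulnC -expnS.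
have le2 : 2 * n%:R / (m ^ 3)%:R ^+ 2 <= 32 / m%:R :> R.
  rewrite ler_pdivrMr ?exprn_gt0 ?ltr0n // mulrAC ler_pdivlMr //.
  rewrite -natrX -!natrM ler_nat -expnM.
  have : (n <= (2 * m) ^ 4)%N.
    by apply: leq_trans (ltnW nm) _; rewrite leq_exp2r //; lia.
  rewrite expnMn (expnD m 4 2) (expnS m 1) expn1.
  by move: (m ^ 4)%N => X; nia.
rewrite mulrDr -addrA [leRHS]splitr lerD //.
apply: (@le_trans _ _ ((C + 32) / m%:R)).
  by rewrite [leRHS]mulrDl lerD // ler_wpM2l.
have : 2 * (C + 32) / eps < m%:R.
  by apply: (lt_le_trans (truncnS_gt _)); rewrite ler_nat.
rewrite ltr_pdivrMr // => h.
by rewrite ler_pdivrMr // mulrAC ler_pdivlMr //; lra.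
Qed.

End Divisibility.

(** * The sieve *)

Lemma gcdn_eq_mul (j t m : nat) : (0 < t)%N ->
  gcdn j (t * m) = t -> (t %| j)%N /\ gcdn (j %/ t) m = 1%N.
Proof.
move=> t0 E; have tj : (t %| j)%N by rewrite -E dvdn_gcdl.
split=> //; apply/eqP; rewrite -(eqn_pmul2l t0) muln_gcdr muln1 mulnC divnK //.
by rewrite E.
Qed.

(** If t | j then gcd(j, t m) = t gcd(j / t, m), so exactly one divisor i contributes. *)
Lemma dvdn_sum_gcdn (R : nzRingType) (j t m : nat) : (0 < t)%N -> (0 < m)%N ->
  (t %| j)%N%:R = \sum_(i <- divisors m) (gcdn j (t * m) == t * i)%N%:R :> R.
Proof.
move=> t0 m0; have [tj|tj] := boolP (t %| j)%N; last first.
  rewrite big1 // => i _; case: eqP => // E; case/negP: tj.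
  by rewrite (dvdn_trans _ (dvdn_gcdl j (t * m))) // E dvdn_mulr.
have E : gcdn j (t * m) = (t * gcdn (j %/ t) m)%N.
  by rewrite muln_gcdr [(t * (j %/ t))%N]mulnC divnK.
rewrite (bigD1_seq (gcdn (j %/ t) m)) ?divisors_uniq -?dvdn_divisors ?dvdn_gcdr //=.
rewrite E eqxx big1 ?addr0 // => i /negPf ne.
by rewrite eqn_pmul2l // eq_sym ne.
Qed.

(* M n phi is the expectation of phi at the gcd of a random word of length n   *)
(* or n + 1.                                                                   *)
Section Sieve.
Variables (R : realType) (k : nat) (M : nat -> (nat -> R) -> R).
Hypothesis k2 : (2 <= k)%N.
Hypothesis MD : forall n (phi psi : nat -> R),
  M n (fun j => phi j + psi j) = M n phi + M n psi.
Hypothesis MZ : forall n a (phi : nat -> R), M n (fun j => a * phi j) = a * M n phi.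
Hypothesis M_le : forall n (phi psi : nat -> R),
  (forall j, phi j <= psi j) -> M n phi <= M n psi.
Hypothesis M1 : forall n, M n (fun=> 1) = 1.
Hypothesis M_dvd : forall d, (0 < d)%N ->
  M n (fun j => (d %| j)%N%:R) @[n --> \oo] --> (d%:R ^- k : R).
Hypothesis M_tail : forall eps : R, 0 < eps ->
  exists D, \forall n \near \oo, M n (fun j => (D < j)%N%:R) <= eps.

Let eqM n (phi psi : nat -> R) : phi =1 psi -> M n phi = M n psi.
Proof. by move=> /funext ->. Qed.

Let M0 n : M n (fun=> 0) = 0.
Proof.
by transitivity (M n (fun=> 0 * 0)); [apply: eqM => j; rewrite mulr0|rewrite MZ mul0r].
Qed.

Let MB n (phi psi : nat -> R) : M n (fun j => phi j - psi j) = M n phi - M n psi.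
Proof.
rewrite -[X in _ = _ + X]mulN1r -MZ -MD; apply: eqM => j; by rewrite mulN1r.
Qed.

Let M_sum n (I : Type) (r : seq I) (P : pred I) (F : I -> nat -> R) :
  M n (fun j => \sum_(i <- r | P i) F i j) = \sum_(i <- r | P i) M n (F i).
Proof.
elim: r => [|i r IHr].
  by rewrite big_nil -(M0 n); apply: eqM => j; rewrite big_nil.
rewrite big_cons -IHr; case: ifP => Pi; last by apply: eqM => j; rewrite big_cons Pi.
by rewrite -MD; apply: eqM => j; rewrite big_cons Pi.
Qed.

Let M_ge0 n (phi : nat -> R) : (forall j, 0 <= phi j) -> 0 <= M n phi.
Proof. by move=> phi0; rewrite -(M0 n); apply: M_le. Qed.

(* Strong induction on m, since t | j holds iff gcd (j, t m) = t i for a       *)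
(* (unique) divisor i of m; this replaces Moebius inversion.                   *)
Lemma sieve_gcdn m : (0 < m)%N -> exists c : R, forall t, (0 < t)%N ->
  M n (fun j => (gcdn j (t * m) == t)%:R) @[n --> \oo] --> t%:R ^- k * c.
Proof.
elim/ltn_ind: m => m IHm m0.
have /choice[c cP] : forall m', exists c : R, (m' < m)%N -> (0 < m')%N ->
    forall t, (0 < t)%N ->
    M n (fun j => (gcdn j (t * m') == t)%:R) @[n --> \oo] --> t%:R ^- k * c.
  move=> m'; have [lt|] := boolP (m' < m)%N; last by exists 0.
  have [m'0|] := boolP (0 < m')%N; last by exists 0.
  by have [c cP] := IHm _ lt m'0; exists c.
(* The divisor 1 gives the wanted term. Any other i falls under the induction hypothesis for t i and
   m / i, and (t i)^-k = t^-k i^-k keeps the constant free of t. *)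
exists (1 - \sum_(i <- divisors m | i != 1%N) i%:R ^- k * c (m %/ i)%N) => t t0.
have -> : (fun n => M n (fun j => (gcdn j (t * m) == t)%:R)) = (fun n =>
    M n (fun j => (t %| j)%N%:R) - \sum_(i <- divisors m | i != 1%N)
      M n (fun j => (gcdn j (t * m) == t * i)%N%:R)).
  apply/funext => n; rewrite -M_sum -MB; apply: eqM => j.
  rewrite (dvdn_sum_gcdn R j t0 m0) (bigD1_seq 1%N) ?divisors_uniq -?dvdn_divisors //=.
  by rewrite muln1 addrK.
rewrite mulrBr mulr1; apply: cvgB; first exact: M_dvd.
rewrite mulr_sumr big_seq_cond.
under eq_fun do rewrite big_seq_cond.
apply: cvgn_sum => i /andP[im i1].
have {}im : (i %| m)%N by rewrite dvdn_divisors.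
have i0 : (0 < i)%N by apply: dvdn_gt0 im.
rewrite mulrA -invfM -exprMn -natrM.
have {1}-> : (t * m = t * i * (m %/ i))%N by rewrite -mulnA [(i * _)%N]mulnC divnK.
apply: cP; rewrite ?muln_gt0 ?t0 ?divn_gt0 ?(dvdn_leq _ im) //.
by rewrite ltn_Pdiv //; lia.
Qed.

(** The value 0 is a multiple of every d, so in the limit its probability is at most d^-k for all
    d. *)
Let M_small (eps : R) : 0 < eps -> exists D, \forall n \near \oo,
  M n (fun j => (j == 0)%N%:R) + M n (fun j => (D < j)%N%:R) <= eps.
Proof.
move=> e0; have e2 : 0 < eps / 2 by rewrite divr_gt0.
have [D Dn] := M_tail e2; exists D.
pose d := (Num.truncn (4 / eps)).+1.
have d_le : d%:R ^- k <= eps / 4.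
  have d1 : 1 <= d%:R :> R by rewrite ler1n.
  have : 4 / eps < d%:R by rewrite truncnS_gt.
  rewrite ltr_pdivrMr // => h.
  apply: (@le_trans _ _ d%:R^-1).
    by rewrite lef_pV2 ?posrE ?exprn_gt0 ?ltr0n // ler_eXnr //; lia.
  by rewrite -div1r ler_pdivrMr ?ltr0n //; lra.
have /cvgrPdist_le/(_ (eps / 4)) := M_dvd (d := d) isT.
rewrite divr_gt0 // => /(_ isT) dn.
near=> n.
rewrite [leRHS]splitr; apply: lerD; last by near: n.
apply: (@le_trans _ _ (M n (fun j => (d %| j)%N%:R))).
  by apply: M_le => j; case: eqP => // ->; rewrite dvdn0.
have : `|d%:R ^- k - M n (fun j => (d %| j)%N%:R)| <= eps / 4 by near: n.
rewrite distrC => /ler_distlDr; lra.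
Unshelve. all: by end_near.
Qed.

(* For m = D`!, the events gcd (j, t m) = t and j = t differ only when j = 0   *)
(* or j > D.                                                                   *)
Lemma sieve_ratio t : (0 < t)%N ->
  M n (fun j => (j == t)%:R) - t%:R ^- k * M n (fun j => (j == 1)%N%:R)
    @[n --> \oo] --> (0 : R).
Proof.
move=> t0; apply/cvgr0Pnorm_le => eps e0.
have e8 : 0 < eps / 8 by rewrite divr_gt0.
have [D Dn] := M_small e8.
have [c cP] := sieve_gcdn (fact_gt0 D).
have approx u n : (0 < u)%N -> `|M n (fun j => (j == u)%:R) -
      M n (fun j => (gcdn j (u * D`!) == u)%:R)| <=
    M n (fun j => (j == 0)%N%:R) + M n (fun j => (D < j)%N%:R).
  move=> u0.
  have pw j : (j == u) = (gcdn j (u * D`!) == u) \/ (j == 0)%N \/ (D < j)%N.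
    have [->|ju] := eqVneq j u; first by rewrite (gcdn_idPl _) ?dvdn_mulr // eqxx; left.
    have [E|] := eqVneq (gcdn j (u * D`!)) u; last by left.
    right; have [uj g1] := gcdn_eq_mul u0 E.
    have [->|j0] := posnP j; first by left.
    right; rewrite ltnNge; apply/negP => jD.
    have ju1 : (j %/ u <= D)%N := leq_trans (leq_div _ _) jD.
    have : (j %/ u %| D`!)%N by rewrite dvdn_fact // ju1 divn_gt0 // dvdn_leq.
    move=> /gcdn_idPl; rewrite g1 => E1; case/eqP: ju.
    by rewrite -(divnK uj) -E1 mul1n.
  have bool_le (b1 b2 b3 b4 : bool) : b1 = b2 \/ b3 \/ b4 ->
      b1%:R - b2%:R <= b3%:R + b4%:R :> R.
    by case: b1 b2 b3 b4 => [] [] [] [] [|[|]] //= _; lra.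
  rewrite -MB -MD ler_norml; apply/andP; split; last first.
    by apply: M_le => j; apply: bool_le.
  rewrite lerNl -mulN1r -MZ; apply: M_le => j; rewrite mulN1r opprB.
  by apply: bool_le; case: (pw j) => [->|]; [left|right].
have /cvgrPdist_le/(_ _ e8) ct := cP t t0.
have /cvgrPdist_le/(_ _ e8) c1 := cP 1%N isT.
have /andP[tk0 tk1] : 0 <= (t%:R ^- k : R) <= 1.
  by rewrite invr_ge0 exprn_ge0 //= invf_le1 ?exprn_gt0 ?exprn_ege1 ?ltr0n ?ler1n.
near=> n.
have small : M n (fun j => (j == 0)%N%:R) + M n (fun j => (D < j)%N%:R) <= eps / 8.
  by near: n.
have := le_trans (approx t n t0) small; have := le_trans (approx 1%N n isT) small.
have : `|t%:R ^- k * c - M n (fun j => (gcdn j (t * D`!) == t)%:R)| <= eps / 8.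
  by near: n.
have : `|1%:R ^- k * c - M n (fun j => (gcdn j (1 * D`!) == 1)%N%:R)| <= eps / 8.
  by near: n.
rewrite expr1n invr1 mul1r.
set a1 := M n (fun j => (j == 1)%N%:R); set at' := M n (fun j => (j == t)%:R).
move: (M n _) (M n _) => b1 bt h1 ht h1' ht'.
have : `|t%:R ^- k * (c - a1)| <= `|c - a1|.
  by rewrite normrM ger0_norm // ler_piMl.
have : `|c - a1| <= eps / 4.
  by rewrite ler_norml; move: h1 h1'; rewrite !ler_norml => /andP[? ?] /andP[? ?]; lra.
move: (t%:R ^- k) ht => x ht h2 h3; have {h2 h3} := le_trans h3 h2.
rewrite !ler_norml mulrBr; move: ht ht'; rewrite !ler_norml.
by move=> /andP[? ?] /andP[? ?] /andP[? ?]; lra.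
Unshelve. all: by end_near.
Qed.

Variable z : R.
Hypothesis z_cvg : series (fun i => i.+1%:R ^- k : R) n @[n --> \oo] --> z.

(** Summing [sieve_ratio] over 1 <= t <= T compares a partial zeta sum times the probability of 1
    with the mass of [1, T], which tightness keeps near 1. *)
Lemma sieve_unit : z * M n (fun j => (j == 1)%N%:R) @[n --> \oo] --> (1 : R).
Proof.
apply/cvgrPdist_le => eps e0.
have e4 : 0 < eps / 4 by rewrite divr_gt0.
have [D Dn] := M_small e4.
have /cvgrPdist_le/(_ _ e4)[T0 _ T0P] := z_cvg.
pose T := maxn T0 D.
have zT : `|z - series (fun i => i.+1%:R ^- k : R) T| <= eps / 4.
  by apply: T0P => /=; rewrite leq_maxl.
pose delta t n := M n (fun j => (j == t)%:R) - t%:R ^- k * M n (fun j => (j == 1)%N%:R).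
have : \sum_(0 <= i < T) delta i.+1 n @[n --> \oo] --> \sum_(0 <= i < T) (0 : R).
  by apply: cvgn_sum => i _; apply: sieve_ratio.
rewrite big1 // => /cvgr0Pnorm_le/(_ _ e4) dn.
near=> n.
set x := M n (fun j => (j == 1)%N%:R).
have x01 : 0 <= x <= 1.
  by rewrite M_ge0 //= -[leRHS](M1 n); apply: M_le => j; case: eqP.
have total : \sum_(0 <= i < T) M n (fun j => (j == i.+1)%:R) =
    1 - M n (fun j => (j == 0)%N%:R) - M n (fun j => (T < j)%N%:R).
  rewrite -[X in _ = X - _ - _](M1 n) -!MB -M_sum; apply: eqM => j.
  case: (posnP j) => [->|j0].
    by rewrite big1 // mulr1n subrr subr0.
  rewrite mulr0n subr0; case: ltnP => jT; rewrite ?mulr1n ?mulr0n.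
    rewrite subrr big_nat big1 // => i /andP[_ iT].
    by rewrite gtn_eqF // (leq_ltn_trans iT).
  rewrite subr0 (bigD1_seq j.-1) ?iota_uniq ?mem_index_iota //=; last by lia.
  rewrite prednK // eqxx big1 ?addr0 // => i /negPf ij.
  by rewrite -{1}(prednK j0) eqSS eq_sym ij.
have {}total : series (fun i => i.+1%:R ^- k : R) T * x = 1 -
    M n (fun j => (j == 0)%N%:R) - M n (fun j => (T < j)%N%:R) -
    \sum_(0 <= i < T) delta i.+1 n.
  by rewrite -total -sumrB /series /= mulr_suml; apply: eq_bigr => i _; rewrite /delta subKr.
have small : M n (fun j => (j == 0)%N%:R) + M n (fun j => (T < j)%N%:R) <= eps / 4.
  apply: (@le_trans _ _ (M n (fun j => (j == 0)%N%:R) + M n (fun j => (D < j)%N%:R))).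
    rewrite lerD2l; apply: M_le => j; rewrite ler_nat.
    by have := leq_maxr T0 D; rewrite -/T; do 2!case: ltnP => //; lia.
  by near: n.
have small0 : 0 <= M n (fun j => (j == 0)%N%:R) + M n (fun j => (T < j)%N%:R).
  by rewrite addr_ge0 // M_ge0.
have dle : `|\sum_(0 <= i < T) delta i.+1 n| <= eps / 4 by near: n; exact: dn.
case/andP: x01 => x0 x1.
have : `|(z - series (fun i => i.+1%:R ^- k : R) T) * x| <= eps / 4.
  by rewrite normrM (ger0_norm x0) (le_trans _ zT) // ler_piMr.
rewrite mulrBl total; move: dle small small0; rewrite !ler_norml.
by move=> /andP[? ?] ? ? /andP[? ?]; lra.
Unshelve. all: by end_near.
Qed.

Lemma sieve t : z != 0 -> (0 < t)%N ->
  M n (fun j => (j == t)%:R) @[n --> \oo] --> (t%:R ^- k / z : R).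
Proof.
move=> z0 t0.
have -> : (fun n => M n (fun j => (j == t)%:R)) = (fun n =>
    (M n (fun j => (j == t)%:R) - t%:R ^- k * M n (fun j => (j == 1)%N%:R)) +
    t%:R ^- k / z * (z * M n (fun j => (j == 1)%N%:R))).
  by apply/funext => n; rewrite mulrA divfK // subrK.
rewrite -[X in _ --> X]add0r; apply: cvgD; first exact: sieve_ratio.
rewrite -[X in _ --> X]mulr1; apply: cvgM; first exact: cvg_cst.
exact: sieve_unit.
Qed.

End Sieve.

(** * Densities *)

Section UnitIntervalSequence.
Variables (R : realType) (u : nat -> R).
Hypothesis u01 : forall n, 0 <= u n <= 1.

Let u_ub : has_ubound (range u).
Proof. by exists 1 => _ [n _ <-]; have /andP[] := u01 n. Qed.

Let u_lb : has_lbound (range u).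
Proof. by exists 0 => _ [n _ <-]; have /andP[] := u01 n. Qed.

Let infs_cvg : cvgn (infs u).
Proof. by apply/cvg_ex; eexists; exact: cvg_infs_sup. Qed.

Let sups_cvg : cvgn (sups u).
Proof. by apply/cvg_ex; eexists; exact: cvg_sups_inf. Qed.

Lemma limn_inf_ge (v : nat -> R) (L : R) N : v n @[n --> \oo] --> L ->
  (forall n, (N <= n)%N -> v n <= u n) -> L <= limn_inf u.
Proof.
move=> vL vu; apply/ler_addgt0Pr => eps e0; rewrite -lerBlDr.
move/cvgrPdist_le : vL => /(_ _ e0)[N' _ vN'].
apply: limr_ge => //; exists (maxn N N') => // n /=; rewrite geq_max => /andP[Nn N'n].
apply: lb_le_inf; first by exists (u n), n => /=.
move=> _ [m /= nm <-]; apply: le_trans (vu m (leq_trans Nn nm)).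
have := vN' m (leq_trans N'n nm); rewrite /= ler_norml => /andP[_]; lra.
Qed.

Lemma limn_sup_le (v : nat -> R) (L : R) N : v n @[n --> \oo] --> L ->
  (forall n, (N <= n)%N -> u n <= v n) -> limn_sup u <= L.
Proof.
move=> vL vu; apply/ler_addgt0Pr => eps e0.
move/cvgrPdist_le : vL => /(_ _ e0)[N' _ vN'].
apply: limr_le => //; exists (maxn N N') => // n /=; rewrite geq_max => /andP[Nn N'n].
apply: ge_sup; first by exists (u n), n => /=.
move=> _ [m /= nm <-]; apply: le_trans (vu m (leq_trans Nn nm)) _.
have := vN' m (leq_trans N'n nm); rewrite /= ler_norml => /andP[+ _]; lra.
Qed.

Lemma limn_inf_le_sup : limn_inf u <= limn_sup u.
Proof.
apply: ler_lim => //; exists 0%N => // n _ /=.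
have un : sdrop u n (u n) by exists n => /=.
apply: (@le_trans _ _ (u n)).
  by apply: ge_inf => //; exists 0 => _ [m _ <-]; have /andP[] := u01 m.
by apply: ub_le_sup => //; exists 1 => _ [m _ <-]; have /andP[] := u01 m.
Qed.

End UnitIntervalSequence.

(** * The zeta series at k *)

Section Zeta.
Variables (R : realType) (k : nat).
Hypothesis k2 : (2 <= k)%N.

Let z (n : nat) : R := series (fun i => i.+1%:R ^- k) n.

Let zetaE : zeta (k%:R : R) = limn z.
Proof.
rewrite /zeta; congr (limn (series _)); apply/funext => n.
by rewrite powRN powR_mulrn.
Qed.

Let z_nd : {homo z : m n / (m <= n)%N >-> m <= n}.
Proof.
apply/nondecreasing_seqP => n.
by rewrite /z /series /= big_nat_recr //= lerDl invr_ge0 exprn_ge0.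
Qed.

Lemma zeta_cvg : z n @[n --> \oo] --> zeta (k%:R : R).
Proof.
rewrite zetaE; apply: nondecreasing_is_cvgn => //.
exists 2 => _ [n _ <-]; apply: le_trans (z_nd (leqnSn n)) _.
rewrite /z /series /= big_nat_recl // expr1n invr1 -[leRHS]/(1 + 1) lerD2l.
have := sum_inv_sqr_le R (D := 1) n.+1 (isT : (0 < 1)%N); rewrite invr1; apply: le_trans.
rewrite 2!big_add1 /=; apply: ler_sum => i _.
by rewrite lef_pV2 ?posrE ?exprn_gt0 // ler_eXn2l // ltr1n.
Qed.

Lemma zeta_gt1 : 1 < zeta (k%:R : R).
Proof.
have zc : cvgn z by apply/cvg_ex; exists (zeta (k%:R : R)); exact: zeta_cvg.
rewrite zetaE; apply: lt_le_trans (nondecreasing_cvgn_le z_nd zc 2).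
by rewrite /z /series /= !big_nat_recr //= big_nil add0r expr1n invr1 ltrDl invr_gt0 exprn_gt0.
Qed.

End Zeta.

(** * Spheres and balls as lists of reduced words *)

Section Counting.
Variable k : nat.
Hypothesis k2 : (2 <= k)%N.

Fixpoint ball_words (n : nat) : seq (seq (letter k)) :=
  if n is m.+1 then ball_words m ++ rwords k n else rwords k 0.

Lemma mem_ball_words n s : (s \in ball_words n) = (size s <= n)%N && reduced s.
Proof.
elim: n => [|n IHn]; first by rewrite mem_rwords leqn0.
by rewrite mem_cat IHn mem_rwords -andb_orl [in RHS]leq_eqVlt orbC.
Qed.

Lemma ball_words_uniq n : uniq (ball_words n).
Proof.
elim: n => [|n IHn]; rewrite ?rwords_uniq // cat_uniq IHn rwords_uniq andbT.
apply/hasPn => s; rewrite mem_rwords => /andP[/eqP sn _].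
by rewrite /= mem_ball_words sn ltnn.
Qed.

(** An explicit duplicate-free list of the words of [S] gives its finiteness and its cardinal at
    once. *)
Lemma card_words (W : seq (seq (letter k))) (S : set (freegroup k)) :
  uniq W -> all (@reduced k) W -> (forall w : freegroup k, S w <-> word w \in W) ->
  #|` fset_set S|%fset = size W.
Proof.
move=> uW rW SW; pose F := [fset w in (pmap insub W : seq (freegroup k))]%fset.
have -> : S = [set` F].
  by apply/seteqP; split=> w; rewrite /= inE mem_pmap_sub => /SW.
rewrite set_fsetK card_fseq undup_id ?pmap_sub_uniq // size_pmap_sub.
by apply/eqP; rewrite -all_count.
Qed.

Variables (X : set (freegroup k)) (A : pred (seq (letter k))).
Hypothesis XA : forall w : freegroup k, X w <-> A (word w).

Lemma gamma_count n : gamma n X = count A (rwords k n).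
Proof.
rewrite /gamma (card_words (W := [seq s <- rwords k n | A s])) ?size_filter //.
- by rewrite filter_uniq ?rwords_uniq.
- by apply/allP => s; rewrite mem_filter mem_rwords => /and3P[].
move=> w; rewrite mem_filter mem_rwords word_reduced andbT.
split=> [[/XA -> <-]|/andP[/XA Xw /eqP <-]] //.
by rewrite /wlen eqxx.
Qed.

Lemma rho_count n : rho n X = count A (ball_words n).
Proof.
rewrite /rho (card_words (W := [seq s <- ball_words n | A s])) ?size_filter //.
- by rewrite filter_uniq ?ball_words_uniq.
- by apply/allP => s; rewrite mem_filter mem_ball_words => /and3P[].
move=> w; rewrite mem_filter mem_ball_words word_reduced andbT.
split=> [[/XA -> le_n]|/andP[/XA Xw le_n]] //.
Qed.

End Counting.

(** * Comparison of balls with spheres *)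

Section Ratios.
Variables (R : realType) (k : nat).
Hypothesis k2 : (2 <= k)%N.
Implicit Types (X : set (freegroup k)) (A : pred (seq (letter k))).

Let q : R := 2 * k%:R - 1.

Let qE : (2 * k).-1%:R = q.
Proof. by rewrite /q -natrM -[1]/(1%:R) -natrB; [congr _%:R|]; lia. Qed.

Let q_ge3 : 3 <= q.
Proof. by rewrite -qE ler_nat; lia. Qed.

Definition word_ratio A : nat -> R := wmean (fun s => (A s)%:R).

Lemma gamma_ratio X A n : (forall w : freegroup k, X w <-> A (word w)) ->
  (gamma n X)%:R / (gamma n [set: freegroup k])%:R = word_ratio A n.
Proof.
move=> XA; rewrite (gamma_count XA) (@gamma_count _ setT predT) // count_predT.
congr (_ / _); rewrite -sum1_count natr_sum [LHS]big_mkcond.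
by apply: eq_bigr => s _; case: ifP.
Qed.

Lemma annular_ratioE X A n : (forall w : freegroup k, X w <-> A (word w)) ->
  annular_ratio R X n.+1 = 2^-1 * (word_ratio A n + word_ratio A n.+1).
Proof. by move=> XA; rewrite /annular_ratio /= !(gamma_ratio _ XA). Qed.

Lemma size_ball_words n :
  (q - 1) * (size (ball_words k n))%:R <= (2 * k)%:R * q ^+ n.
Proof.
have NE : (2 * k)%:R = q + 1 :> R by rewrite /q natrM; ring.
(* Exact value of the geometric sum of the sphere sizes. *)
suff: (q - 1) * (size (ball_words k n))%:R = (2 * k)%:R * q ^+ n - 2 by move=> ->; lra.
elim: n => [|n IHn]; first by rewrite /= NE; ring.
by rewrite size_cat natrD mulrDr IHn size_rwordsS // qE NE exprS; ring.
Qed.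

Definition ball_word_ratio A n : R :=
  (count A (ball_words k n))%:R / (size (ball_words k n))%:R.

Lemma ball_ratioE X A n : (forall w : freegroup k, X w <-> A (word w)) ->
  ball_ratio R X n = ball_word_ratio A n.
Proof.
by move=> XA; rewrite /ball_ratio (rho_count XA) (@rho_count _ setT predT) // count_predT.
Qed.

Lemma size_ball_words_gt0 n : 0 < (size (ball_words k n))%:R :> R.
Proof.
case: n => [|n]; first exact: ltr01.
rewrite (_ : ball_words k n.+1 = ball_words k n ++ rwords k n.+1) // size_cat natrD.
by rewrite ltr_wpDl // size_rwords_gt0.
Qed.

(** Only the two outermost spheres are kept; by [size_ball_words] each is at least a fraction (q -
    1) / q^2 of the ball. *)
Lemma ball_word_ratio_ge A n :
  (q - 1) / q ^+ 2 * (word_ratio A n.+1 + word_ratio A n.+2) <= ball_word_ratio A n.+2.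
Proof.
have q_gt0 : 0 < q by apply: lt_le_trans q_ge3.
have N_gt0 : 0 < (2 * k)%:R :> R by rewrite ltr0n; lia.
set B : R := (size (ball_words k n.+2))%:R.
have B0 : 0 < B by apply: size_ball_words_gt0.
have ratioE m : word_ratio A m = (count A (rwords k m))%:R / (size (rwords k m))%:R.
  congr (_ / _); rewrite -sum1_count natr_sum [RHS]big_mkcond.
  by apply: eq_bigr => s _; case: ifP.
have term m : (n < m)%N -> (q - 1) / q ^+ 2 * word_ratio A m <= (count A (rwords k m))%:R / B.
  case: m => // m nm; rewrite ratioE mulrCA ler_wpM2l // size_rwordsS // qE.
  rewrite ler_pdivrMr ?mulr_gt0 ?exprn_gt0 // [leRHS]mulrC ler_pdivlMr //.
  rewrite mulrAC ler_pdivrMr ?exprn_gt0 //.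
  apply: le_trans (size_ball_words n.+2) _; rewrite -mulrA -exprD.
  rewrite ler_pM2l // ler_weXn2l ?(le_trans _ q_ge3) ?ler1n //; lia.
rewrite mulrDr; apply: le_trans (lerD (term n.+1 _) (term n.+2 _)) _ => //.
rewrite -mulrDl ler_pM2r ?invr_gt0 // -natrD ler_nat /= !count_cat.
by rewrite -addnA leq_addl.
Qed.

Lemma word_ratioC A n : word_ratio (predC A) n = 1 - word_ratio A n.
Proof.
apply/eqP; rewrite eq_sym subr_eq /word_ratio -(wmeanD (R := R)) eq_sym; apply/eqP.
rewrite -[RHS](wmean_cst k2 1 n); apply: (eq_wmean k2) => s _ /=.
by case: (A s); rewrite /= ?add0r ?addr0.
Qed.

Lemma ball_word_ratioC A n : ball_word_ratio (predC A) n = 1 - ball_word_ratio A n.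
Proof.
apply/eqP; rewrite eq_sym subr_eq /ball_word_ratio -mulrDl -natrD addnC count_predC.
by rewrite divff // gt_eqF // size_ball_words_gt0.
Qed.

Lemma ball_word_ratio01 A n : 0 <= ball_word_ratio A n <= 1.
Proof.
by rewrite divr_ge0 //= ler_pdivrMr ?size_ball_words_gt0 // mul1r ler_nat count_size.
Qed.

End Ratios.

Lemma visibleE k t (w : freegroup k) : (0 < t)%N ->
  visible k t w <-> wgcd (word w) == t.
Proof.
move=> t0; split=> [[_ gw]|/eqP E]; first exact/eqP.
split=> //; apply: contraTneq t0 => w0.
rewrite -E /wgcd -[abel_word _]/(abel w) w0 /gcd_coords big1 // => i _.
by rewrite mxE.
Qed.

Lemma annular_visible_cvg (R : realType) k t : (2 <= k)%N -> (0 < t)%N ->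
  annular_ratio R (visible k t) n @[n --> \oo] -->
    1 / (t%:R ^+ k * zeta (k%:R : R)).
Proof.
move=> k2 t0; rewrite -cvg_shiftS.
(* Averaging two consecutive lengths is what gives divisibility by d the limit d^-k. *)
pose M n (phi : nat -> R) := 2^-1 *
  (wmean (fun s : seq (letter k) => phi (wgcd s)) n +
   wmean (fun s : seq (letter k) => phi (wgcd s)) n.+1).
have -> : (fun n => annular_ratio R (visible k t) n.+1) =
    (fun n => M n (fun j => (j == t)%:R)).
  apply/funext => n; rewrite (annular_ratioE R (A := fun s => wgcd s == t)) // => w.
  exact: visibleE.
rewrite div1r invfM.
have z1 := zeta_gt1 R k2.
apply: (sieve (k := k) (M := M)) => //; last first.
- by rewrite gt_eqF // (lt_trans _ z1).
- exact: zeta_cvg.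
- move=> eps e0; have [D [N _ ND]] := gcd_tail_small k2 e0.
  exists D; exists N => // n /= Nn.
  have h1 := ND n Nn; have h2 := ND n.+1 (leqW Nn).
  move: h1 h2; rewrite /= /gcd_tail /M.
  move: (wmean _ n) (wmean _ n.+1) => x y; lra.
- move=> d d0; have -> : d%:R ^- k = 2^-1 * (2 / d%:R ^+ k) :> R.
    by rewrite mulrA mulVf ?mul1r.
  by apply: cvgM; [exact: cvg_cst|exact: div_prob_cvg].
- by move=> n; rewrite /M !(wmean_cst k2); lra.
- move=> n phi psi le_phi; rewrite /M ler_pM2l ?invr_gt0 //.
  by rewrite lerD // (wmean_le k2).
- by move=> n a phi; rewrite /M !wmeanZ; ring.
- by move=> n phi psi; rewrite /M !wmeanD; ring.
Qed.

Lemma ball_visible_bounds (R : realType) k t n : (2 <= k)%N -> (0 < t)%N -> (2 <= n)%N ->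
  let c : R := (4 * k%:R - 4) / (2 * k%:R - 1) ^+ 2 in
  c * annular_ratio R (visible k t) n <= ball_ratio R (visible k t) n <=
  1 - c * (1 - annular_ratio R (visible k t) n).
Proof.
move=> k2 t0; case: n => [|[|n]] //= _; set c := _ / _.
pose A (s : seq (letter k)) := wgcd s == t.
have XA w : visible k t w <-> A (word w) by exact: visibleE.
rewrite !(annular_ratioE R _ XA) (ball_ratioE R _ XA).
(* The complement of [A] yields the upper bound. *)
have := ball_word_ratio_ge R k2 A n; have := ball_word_ratio_ge R k2 (predC A) n.
rewrite !word_ratioC // ball_word_ratioC //.
(* The factor 2 undoes the 1/2 in the annular ratio. *)
have -> : c = 2 * ((2 * k%:R - 1 - 1) / (2 * k%:R - 1) ^+ 2).
  by rewrite /c mulrA; congr (_ / _); ring.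
move: ((_ - 1) / _) (ball_word_ratio _ _ _) => r b.
move: (word_ratio _ _ _) (word_ratio _ _ _) => x y h1 h2.
by apply/andP; split; lra.
Qed.

Theorem theorem2 (R : realType) (k : nat) (hk : (2 <= k)%N)
    (t : nat) (ht : (1 <= t)%N) :
  (has_strict_annular_density R (visible k t) /\
   strict_annular_density R (visible k t) =
     1 / (t%:R ^+ k * zeta (k%:R : R))) /\
  [/\ 0 < (4 * k%:R - 4) / ((2 * k%:R - 1) ^+ 2 * t%:R ^+ k * zeta (k%:R : R)),
      (4 * k%:R - 4) / ((2 * k%:R - 1) ^+ 2 * t%:R ^+ k * zeta (k%:R : R))
        <= limn_inf (ball_ratio R (visible k t)),
      limn_inf (ball_ratio R (visible k t))
        <= limn_sup (ball_ratio R (visible k t)),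
      limn_sup (ball_ratio R (visible k t))
        <= 1 - (4 * k%:R - 4) / (2 * k%:R - 1) ^+ 2
                 * (1 - 1 / (t%:R ^+ k * zeta (k%:R : R))) &
      1 - (4 * k%:R - 4) / (2 * k%:R - 1) ^+ 2
            * (1 - 1 / (t%:R ^+ k * zeta (k%:R : R))) < 1].
Proof.
have ann := annular_visible_cvg (R := R) hk ht.
have bnd := @ball_visible_bounds R k t _ hk ht.
have u01 n : 0 <= ball_ratio R (visible k t) n <= 1.
  rewrite (ball_ratioE R (A := fun s => wgcd s == t)) ?ball_word_ratio01 // => w.
  exact: visibleE.
have z1 := zeta_gt1 R hk.
set z := zeta _ in ann z1 *; set c := (4 * k%:R - 4) / (2 * k%:R - 1) ^+ 2 in bnd *.
have k2R : 2 <= k%:R :> R by rewrite ler_nat.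
have c_gt0 : 0 < c by rewrite divr_gt0 ?exprn_gt0 //; lra.
have t1 : 1 <= t%:R ^+ k :> R by rewrite exprn_ege1 // ler1n.
have tz : 1 < t%:R ^+ k * z by nra.
have -> : (4 * k%:R - 4) / ((2 * k%:R - 1) ^+ 2 * t%:R ^+ k * z) =
    c * (1 / (t%:R ^+ k * z)).
  by rewrite -mulrA invfM mulrA div1r.
set L := 1 / _ in ann *.
have L_gt0 : 0 < L by rewrite divr_gt0 // (lt_trans _ tz).
have L_lt1 : L < 1 by rewrite ltr_pdivrMr ?mul1r // (lt_trans _ tz).
split.
  split; first by apply/cvg_ex; exists L.
  exact: cvg_lim.
split.
- by rewrite mulr_gt0.
- apply: (limn_inf_ge u01 (N := 2) (v := fun n => c * annular_ratio R (visible k t) n)) => //.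
    by apply: cvgM; [exact: cvg_cst|exact: ann].
  by move=> n n2; have /andP[] := bnd n n2.
- exact: limn_inf_le_sup.
- apply: (limn_sup_le u01 (N := 2) (v := fun n => 1 - c * (1 - annular_ratio R (visible k t) n))) => //.
    apply: cvgB; first exact: cvg_cst.
    apply: cvgM; first exact: cvg_cst.
    by apply: cvgB; [exact: cvg_cst|exact: ann].
  by move=> n n2; have /andP[] := bnd n n2.
- by rewrite gtrBl mulr_gt0 // subr_gt0.
Qed.
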